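(* For all integers $n \ge 32$ and $0 \le k \le n$ with $n-k$ even, there exists a CMDRR$(n,k)$.
   Context: A mixed doubles game is a match between two teams, each team consisting of one man and one woman; in a game $M_a F_b$ v $M_c F_d$, $M_a$ and $F_b$ are partners, $M_c$ and $F_d$ are partners, and each player of one team opposes each player of the other team. A complete mixed doubles round robin tournament CMDRR$(n,k)$ is a schedule (set) of mixed doubles games for $n$ men and $n$ women, of which $k$ men and $k$ women are paired into $k$ spouse pairs (a spouse pair is one man and one woman), such that: spouses never play in a game together as partners or opponents; every man and woman who are not spouses are partners exactly once and opponents exactly once; each player who has a spouse opposes every other player of the same sex exactly once; each player who does not have a spouse opposes some other same-sex player who does not have a spouse exactly twice and opposes all other same-sex players exactly once. *)

(* Defs.v *)
From mathcomp Require Import all_boot.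
Set Implicit Arguments. Unset Strict Implicit. Unset Printing Implicit Defensive.

(* Men and women are each indexed by 'I_n.  A game  M_a F_b v M_c F_d  is
   recorded as Game a b c d : team (a,b) against team (c,d). *)
Record game (n : nat) := Game { gm1 : 'I_n; gw1 : 'I_n; gm2 : 'I_n; gw2 : 'I_n }.

(* Spouse pairs: man i and woman i are spouses for i < k (k spouse pairs,
   a canonical labelling); all other players have no spouse. *)
Definition has_spouse (k n : nat) (p : 'I_n) : bool := p < k.
Definition spouses (k n : nat) (m w : 'I_n) : bool :=
  (nat_of_ord m == nat_of_ord w) && (m < k).

Definition game_ok n (g : game n) : bool := (gm1 g != gm2 g) && (gw1 g != gw2 g).

Definition partners_cnt n (s : seq (game n)) (m w : 'I_n) : nat :=
  count (fun g => ((gm1 g == m) && (gw1 g == w)) || ((gm2 g == m) && (gw2 g == w))) s.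
Definition opp_mw_cnt n (s : seq (game n)) (m w : 'I_n) : nat :=
  count (fun g => ((gm1 g == m) && (gw2 g == w)) || ((gm2 g == m) && (gw1 g == w))) s.
Definition opp_mm_cnt n (s : seq (game n)) (m m' : 'I_n) : nat :=
  count (fun g => ((gm1 g == m) && (gm2 g == m')) || ((gm1 g == m') && (gm2 g == m))) s.
Definition opp_ww_cnt n (s : seq (game n)) (w w' : 'I_n) : nat :=
  count (fun g => ((gw1 g == w) && (gw2 g == w')) || ((gw1 g == w') && (gw2 g == w))) s.

Definition same_sex_ok (k n : nat) (opp : 'I_n -> 'I_n -> nat) : Prop :=
  forall p : 'I_n,
    (has_spouse k p -> forall q : 'I_n, q != p -> opp p q = 1) /\
    (~~ has_spouse k p ->
       exists2 q : 'I_n, (q != p) && ~~ has_spouse k q &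
         opp p q = 2 /\ forall r : 'I_n, r != p -> r != q -> opp p r = 1).

Definition is_CMDRR (n k : nat) (s : seq (game n)) : Prop :=
  all (@game_ok n) s /\
  (forall m w : 'I_n, spouses k m w ->
     count (fun g => ((gm1 g == m) || (gm2 g == m)) && ((gw1 g == w) || (gw2 g == w))) s = 0) /\
  (forall m w : 'I_n, ~~ spouses k m w ->
     partners_cnt s m w = 1 /\ opp_mw_cnt s m w = 1) /\
  same_sex_ok k (opp_mm_cnt s) /\
  same_sex_ok k (opp_ww_cnt s).

(* Main.v *)
Require Import Defs.
From Stdlib Require Import NArith.
From mathcomp Require Import all_boot.
From mathcomp Require Import all_algebra zify ring.
Set Implicit Arguments. Unset Strict Implicit. Unset Printing Implicit Defensive.

(* A frame of type h^t u^1 is a set of matches between n = h t + u men and as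
   many women, the players of each sex being split into t holes of size h and
   one of size u: players from different holes meet exactly once in each
   possible way, and players from the same hole never meet.  Putting a CMDRR on
   every hole of a frame yields a CMDRR(n,k), whose spouse pairs can be spread
   over the holes in any way the smaller tournaments allow.

   Two families of frames suffice.  Frames of type 4^t u^1 come from difference
   families over Z_4t with u fixed points; these were found by computer.  As
   CMDRR(4,2) does not exist, a hole of size 4 receives 0 or 4 spouse pairs, and
   the parity is adjusted on the hole of size u.  For gcd(m,6) = 1, giving
   weight 2 to four groups of the transversal design TD(5,m) of lines over Z_m,
   and weights at most 3 to the fifth group, produces frames of type
   (2m)^4 u^1 for all u <= 3m.  Strong induction on n, with n = 8m + u, handles
   all n outside a finite list, and that list is covered by the first family. *)

(** Counting matches in a frame of type [h^t u^1] gives [2u <= h(t-1)]: the players of the hole of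
    size [u] take part in [2uht] distinct matches, out of [ht(ht-h)/2 + htu] in all. This bound
    shapes the proof. For [h = 4] it reads [u <= 2(t-1)], so the sizes 7, 8, 9, 10, one for each
    residue mod 4, are all possible for [u] as soon as [t >= 6], which in principle gives every
    [n >= 31]; [t = 5] admits only 7 and 8 among them, hence 27 and 28. For [h = 2] and [t = 4] it
    reads [u <= 3], whence the bound on the weights. The second family is an instance of Wilson's
    fundamental construction: every block of the design carries a small frame on the copies of its
    points. The condition gcd(m,6) = 1 makes the differences 1, 2, 3 of the first four group indices
    invertible, so that two points of different groups lie on exactly one line. Men and women are
    drawn from one index set, and the four ways of meeting are treated alike, as multisets of
    ordered pairs; gluing, transport and cyclic development then become statements about counts. *)

(** * Matches and the counting of meetings *)

Variant meeting := Partners | OppMW | OppMM | OppWW.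

Definition match_of (T : Type) := ((T * T) * (T * T))%type.

(** Same-sex meetings are listed in both orders, so that their counts are symmetric and all four
    relations can be prescribed in the same way. A man opposing himself would show up on the
    diagonal, where the prescribed count is 0. *)
Definition pairs T (r : meeting) (g : match_of T) : seq (T * T) :=
  let: ((a, b), (c, d)) := g in
  match r with
  | Partners => [:: (a, b); (c, d)]
  | OppMW => [:: (a, d); (c, b)]
  | OppMM => [:: (a, c); (c, a)]
  | OppWW => [:: (b, d); (d, b)]
  end.

Definition all_pairs T r (S : seq (match_of T)) : seq (T * T) :=
  flatten [seq pairs r g | g <- S].

Definition meets (T : eqType) (S : seq (match_of T)) (r : meeting) (x y : T) :=
  count_mem (x, y) (all_pairs r S).

Definition map_match T T' (f : T -> T') (g : match_of T) : match_of T' :=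
  let: ((a, b), (c, d)) := g in ((f a, f b), (f c, f d)).

Lemma all_pairs_map T T' (f : T -> T') r S :
  all_pairs r (map (map_match f) S) =
  [seq (f p.1, f p.2) | p <- all_pairs r S].
Proof.
rewrite /all_pairs map_flatten -!map_comp; congr flatten.
by apply: eq_map => -[[a b] [c d]] /=; case: r.
Qed.

Lemma meets_cat (T : eqType) (S1 S2 : seq (match_of T)) r x y :
  meets (S1 ++ S2) r x y = meets S1 r x y + meets S2 r x y.
Proof. by rewrite /meets /all_pairs map_cat flatten_cat count_cat. Qed.

Lemma meets_flatten (T : eqType) I (F : I -> seq (match_of T)) s r x y :
  meets (flatten [seq F i | i <- s]) r x y = \sum_(i <- s) meets (F i) r x y.
Proof.
elim: s => [|i s IH] /=; first by rewrite big_nil.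
by rewrite big_cons meets_cat IH.
Qed.

(** The map [g] has to invert [f] only on the players that occur in [S]. The tests [f (g x) == x]
    detect the image of [f], outside of which the count vanishes. *)
Lemma meets_map (T T' : eqType) (f : T -> T') (g : T' -> T) S r x y :
  (forall p, p \in all_pairs r S -> g (f p.1) = p.1 /\ g (f p.2) = p.2) ->
  meets (map (map_match f) S) r x y =
  ((f (g x) == x) && (f (g y) == y)) * meets S r (g x) (g y).
Proof.
move=> fK; rewrite /meets all_pairs_map count_map.
case: eqP => /= fgx; last first.
  rewrite mul0n; apply/eqP; rewrite eqn0Ngt -has_count; apply/hasPn => p Sp /=.
  apply/negP => /eqP[px _]; case: fgx; rewrite -px.
  by have [-> _] := fK _ Sp.
case: eqP => /= fgy; last first.
  rewrite mul0n; apply/eqP; rewrite eqn0Ngt -has_count; apply/hasPn => p Sp /=.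
  apply/negP => /eqP[_ py]; case: fgy; rewrite -py.
  by have [_ ->] := fK _ Sp.
rewrite mul1n; apply: eq_in_count => -[p q] Sp /=.
have /= [gfp gfq] := fK _ Sp.
by apply/eqP/eqP => [[<- <-]|[-> ->]]; rewrite ?gfp ?gfq ?fgx ?fgy.
Qed.

(** * Tournaments on arbitrary player sets, and filling of holes *)

(* [tau OppMM] and [tau OppWW] send a spouseless player to the opponent met
   twice. *)
Definition demand (T : eqType) (sp : pred T) (tau : meeting -> T -> T)
    r (x y : T) : nat :=
  match r with
  | Partners | OppMW => ~~ ((x == y) && sp x)
  | OppMM | OppWW => (x != y) + (~~ sp x && (y == tau r x))
  end.

(** The relation [e] says who may meet: it is total for a tournament, and membership in the same
    hole for a union of tournaments on the holes. As same-sex pairs are counted in both orders,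
    [tau OppMM] and [tau OppWW] are forced to be involutions on the spouseless players. *)
Definition scheduled (T : eqType) (V : pred T) (e : rel T) (sp : pred T) S :=
  exists2 tau : meeting -> T -> T,
    (forall r x, V x -> ~~ sp x ->
       [/\ V (tau r x), e x (tau r x), tau r x != x & ~~ sp (tau r x)]) &
    forall r x y, meets S r x y = [&& V x, V y & e x y] * demand sp tau r x y.

Definition holey (T J : eqType) (V : pred T) (c : T -> J) S :=
  forall r x y, meets S r x y = [&& V x, V y & c x != c y].

(** Quantifying over all player lists and all spouse predicates of the given sizes allows a
    tournament to be placed on any hole, with spouses assigned beforehand. *)
Definition avail (n k : nat) := forall (T : eqType) (V : seq T) (sp : pred T),
  uniq V -> size V = n -> count sp V = k ->
  exists S, scheduled [in V] (fun _ _ => true) sp S.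

(** Only the two sizes matter: listing the players with spouses first in both sets and matching
    equal ranks gives a bijection that preserves the spouse status, and the schedule is transported
    along it. *)
Lemma avail_intro (T : eqType) (V : seq T) (sp : pred T) S :
  uniq V -> scheduled [in V] (fun _ _ => true) sp S ->
  avail (size V) (count sp V).
Proof.
move=> uV [tau tauP SP] T' V' sp' uV' sV' cV'.
set W := filter sp V ++ filter (predC sp) V.
set W' := filter sp' V' ++ filter (predC sp') V'.
have pW : perm_eq W V by rewrite perm_filterC.
have pW' : perm_eq W' V' by rewrite perm_filterC.
have uW : uniq W by rewrite (perm_uniq pW).
have uW' : uniq W' by rewrite (perm_uniq pW').
have sWW : size W' = size W by rewrite (perm_size pW) (perm_size pW').
(* Players are needed as default values of [nth]; if there are none, the empty schedule does. *)
have [V0|[x0 x0V]] : V = [::] \/ exists x0, x0 \in V.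
  by case: (V) => [|x s]; [left | right; exists x; rewrite mem_head].
  have V'0 : V' = [::] by apply/eqP; rewrite -size_eq0 sV' V0.
  exists [::]; exists (fun _ => id) => [r x|r x y]; rewrite V'0 ?inE //.
have [x0' x0V'] : exists x0', x0' \in V'.
  case: (V') sV' => [|x s _]; last by exists x; rewrite mem_head.
  by move=> /esym/eqP; rewrite size_eq0 => /eqP V0; rewrite V0 in x0V.
pose f x := nth x0' W' (index x W); pose g x := nth x0 W (index x W').
have fK x : x \in V -> g (f x) = x.
  move=> Vx; rewrite /g /f index_uniq // ?sWW ?index_mem ?(perm_mem pW) //.
  by rewrite nth_index // (perm_mem pW).
have gK x : x \in V' -> f (g x) = x.
  move=> Vx; rewrite /g /f index_uniq // -?sWW ?index_mem ?(perm_mem pW') //.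
  by rewrite nth_index // (perm_mem pW').
have fV x : x \in V -> f x \in V'.
  by move=> Vx; rewrite -(perm_mem pW') mem_nth // sWW index_mem (perm_mem pW).
have gV x : x \in V' -> g x \in V.
  by move=> Vx; rewrite -(perm_mem pW) mem_nth // -sWW index_mem (perm_mem pW').
(* Having a spouse becomes a condition on the rank, with the same threshold on both sides because
   the two counts agree. *)
have spW x : x \in V -> sp x = (index x W < count sp V).
  move=> Vx; rewrite index_cat mem_filter Vx andbT -size_filter.
  case spx : (sp x); last by rewrite ltnNge leq_addr.
  by rewrite index_mem mem_filter spx Vx.
have spW' x : x \in V' -> sp' x = (index x W' < count sp V).
  move=> Vx; rewrite -cV' index_cat mem_filter Vx andbT -size_filter.
  case spx : (sp' x); last by rewrite ltnNge leq_addr.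
  by rewrite index_mem mem_filter spx Vx.
have spf x : x \in V -> sp' (f x) = sp x.
  move=> Vx; rewrite spW' ?fV // spW // /f index_uniq // sWW index_mem.
  by rewrite (perm_mem pW).
have spg x : x \in V' -> sp (g x) = sp' x by move=> Vx; rewrite -spf ?gV // gK.
have SV r p : p \in all_pairs r S -> p.1 \in V /\ p.2 \in V.
  case: p => x y; rewrite -has_pred1 has_count -/(meets S r x y) SP /= andbT.
  by do 2!case: (_ \in V).
exists (map (map_match f) S).
exists (fun r => f \o tau r \o g) => [r x Vx spx | r x y].
  have [||tV _ tx tsp] := tauP r (g x); rewrite ?spg ?gV //=.
  split=> //; rewrite ?fV ?spf //.
  (* If [x] were sent to itself, applying [g] would make [g x] a fixed point of [tau r]. *)
  by apply: contraNneq tx => e; rewrite -[X in _ == g X]e fK.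
rewrite (@meets_map _ _ f g) => [|p /SV[? ?]]; last by rewrite !fK.
rewrite SP /= !andbT mulnA.
have mV z : (f (g z) == z) && (g z \in V) = (z \in V').
  apply/andP/idP => [[/eqP e /fV]|Vz]; first by rewrite e.
  by rewrite gK // gV.
rewrite mulnb andbACA !mV.
case Vx: (x \in V') => //=; case Vy: (y \in V') => //=; rewrite !mul1n.
have egg : (g x == g y) = (x == y).
  by apply/eqP/eqP => [|->//] /(congr1 f); rewrite !gK.
case spx: (sp' x) => /=; first by case: r => //=; rewrite egg spg ?spx.
have [||tV _ _ _] := tauP r (g x); rewrite ?spg ?spx ?gV //.
have etau : (g y == tau r (g x)) = (y == f (tau r (g x))).
  by apply/eqP/eqP => [<-|->]; rewrite ?gK ?fK.
by case: r tV etau => //= _ etau; rewrite egg spg // spx // etau.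
Qed.

(** Tournaments on disjoint classes do not interfere, so the schedules are concatenated one class at
    a time and [tau] is chosen according to the class of its argument. *)
Lemma scheduled_classes (T J : eqType) (V : seq T) (c : T -> J) (sp : pred T) js :
  uniq V -> uniq js ->
  (forall j, j \in js ->
     avail (size [seq x <- V | c x == j]) (count sp [seq x <- V | c x == j])) ->
  exists S, scheduled (fun x => (x \in V) && (c x \in js))
                      (fun x y => c x == c y) sp S.
Proof.
move=> uV; elim: js => [|j js IH] /= => [_ _|/andP[njs ujs] av].
  by exists [::], (fun _ => id) => [r x|r x y]; rewrite in_nil andbF.
have [i ijs|S2 [tau2 tau2P S2P]] := IH ujs.
  by apply: av; rewrite inE ijs orbT.
have [|S1 [tau1 tau1P S1P]] := av j (mem_head _ _) _ _ sp _ erefl erefl.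
  exact: filter_uniq.
exists (S1 ++ S2), (fun r x => if c x == j then tau1 r x else tau2 r x).
  move=> r x /andP[Vx]; rewrite inE; case: eqP => /= [cx _ spx|_ cx spx].
    have [||] := tau1P r x; rewrite ?mem_filter ?cx ?eqxx //.
    by move=> /andP[/eqP-> ->] _ -> ->; rewrite mem_head eqxx.
  have [||/andP[-> ct] /eqP <- -> ->] := tau2P r x; rewrite ?Vx ?cx //.
  by rewrite inE cx orbT eqxx.
move=> r x y; rewrite meets_cat S1P S2P !mem_filter !inE andbT.
have [cx|ncx] := eqVneq (c x) j.
  rewrite (negPf _ : c x \in js = false) ?andbF ?addn0 /=; last by rewrite cx.
  have [cy|ncy] := eqVneq (c y) j; last first.
    by rewrite cx eq_sym (negPf ncy) !andbF !mul0n.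
  by rewrite cx cy eqxx !andbT; congr (_ * _); case: r => //=; rewrite cx eqxx.
rewrite /= mul0n add0n.
have [cy|ncy] := eqVneq (c y) j.
  by rewrite cy (negPf ncx) !andbF !mul0n.
by rewrite /=; congr (_ * _); case: r => //=; rewrite (negPf ncx).
Qed.

(** Players of different holes meet only in [S0], players of one hole only in its tournament. The
    second meeting of a spouseless player takes place inside a hole, so it adds nothing to the pairs
    that the frame covers. *)
Lemma fill_holes (T J : eqType) (V : seq T) (c : T -> J) (sp : pred T) js S0 :
  uniq V -> uniq js -> {in V, forall x, c x \in js} -> holey [in V] c S0 ->
  (forall j, j \in js ->
     avail (size [seq x <- V | c x == j]) (count sp [seq x <- V | c x == j])) ->
  avail (size V) (count sp V).
Proof.
move=> uV ujs Vjs S0P av.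
have [S1 [tau tauP S1P]] := scheduled_classes uV ujs av.
apply: (@avail_intro _ _ _ (S0 ++ S1)) => //; exists tau.
  move=> r x Vx spx.
  by have [||/andP[-> _] _ -> ->] := tauP r x; rewrite ?Vx ?Vjs.
move=> r x y; rewrite meets_cat S0P S1P /= andbT.
case Vx: (x \in V); last by rewrite mul0n.
case Vy: (y \in V); last by rewrite /= ?andbF ?mul0n.
rewrite !Vjs //= mul1n.
have [cxy|ncxy] := eqVneq (c x) (c y); first by rewrite mul1n.
rewrite ?mul0n ?addn0 ?mul1n.
have nxy: x == y = false by apply: contraNF ncxy => /eqP->.
case spx: (sp x); first by case: r => /=; rewrite nxy ?spx.
have [||_ /eqP ct _ _] := tauP r x; rewrite ?Vx ?Vjs ?spx //.
have nt: y == tau r x = false by apply: contraNF ncxy => /eqP ->; rewrite ct.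
by case: r ct nt => _ nt /=; rewrite nxy ?nt ?andbF.
Qed.

(** * Frames *)

Definition universal n := forall k, k <= n -> ~~ odd (n - k) -> avail n k.

Definition frame h t u := exists (T : eqType) (V : seq T) (c : T -> nat) S,
  [/\ uniq V, {in V, forall x, c x <= t}, holey [in V] c S,
      forall j, j < t -> size [seq x <- V | c x == j] = h &
      size [seq x <- V | c x == t] = u].

Lemma count_classes (T : eqType) (V : seq T) (c : T -> nat) t (a : pred T) :
  {in V, forall x, c x <= t} ->
  count a V = \sum_(j < t.+1) count a [seq x <- V | c x == j].
Proof.
elim: V => [|x V IH] cV /=; first by rewrite big1.
rewrite IH => [|y Vy]; last by rewrite cV // inE Vy orbT.
have cx : c x < t.+1 by rewrite ltnS cV // mem_head.
rewrite (bigD1 (Ordinal cx)) //= [in RHS](bigD1 (Ordinal cx)) //= eqxx /= addnA.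
congr (_ + _); apply: eq_bigr => j; rewrite -val_eqE /= => ncx.
by rewrite eq_sym (negPf ncx).
Qed.

(** This serves to give spouses to exactly [k] players of a hole, namely to the first ones. *)
Lemma count_index_lt (T : eqType) (s : seq T) k :
  uniq s -> k <= size s -> count (fun x => index x s < k) s = k.
Proof.
move=> us ks; rewrite -[X in count _ X = _](cat_take_drop k) count_cat.
have := us; rewrite -{1}(cat_take_drop k s) cat_uniq => /and3P[_ /hasPn dis _].
rewrite (eq_in_count (a2 := predT)) => [|x xs]; last first.
  rewrite -[X in index _ X](cat_take_drop k) index_cat xs /=.
  rewrite (leq_trans (n := size (take k s))) //.
    by rewrite index_mem.
  by rewrite size_take_min geq_minl.
rewrite count_predT size_takel // (eq_in_count (a2 := pred0)) => [|x /dis xs].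
  by rewrite count_pred0 addn0.
rewrite -[X in index _ X](cat_take_drop k) index_cat (negPf xs).
by rewrite size_takel // ltnNge leq_addr.
Qed.

Lemma frame_avail h t u (kf : nat -> nat) :
  frame h t u ->
  (forall j, j < t -> kf j <= h /\ avail h (kf j)) ->
  kf t <= u -> avail u (kf t) -> avail (h * t + u) (\sum_(j < t.+1) kf j).
Proof.
move=> [T [V [c [S [uV cV SP sh su]]]]] avh ku avu.
(* In hole [j] the first [kf j] players, in the order of [V], receive spouses. *)
pose sp x := index x [seq y <- V | c y == c x] < kf (c x).
have spj j : kf j <= size [seq x <- V | c x == j] ->
    count sp [seq x <- V | c x == j] = kf j.
  move=> kj; have ucls := filter_uniq (fun x => c x == j) uV.
  rewrite -[RHS](count_index_lt ucls) //.
  by apply: eq_in_count => x; rewrite mem_filter /sp => /andP[/eqP->].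
have cnt j : j <= t -> count sp [seq x <- V | c x == j] = kf j.
  rewrite leq_eqVlt => /orP[/eqP->|jt]; rewrite spj ?su ?sh //.
  by case: (avh _ jt).
have <- : size V = h * t + u.
  rewrite -count_predT (count_classes _ cV) big_ord_recr /= count_predT su.
  congr (_ + _); rewrite (eq_bigr (fun=> h)) => [|j _]; last first.
    by rewrite count_predT sh.
  by rewrite sum_nat_const card_ord mulnC.
have <- : count sp V = \sum_(j < t.+1) kf j.
  by rewrite (count_classes _ cV); apply: eq_bigr => j _; rewrite cnt // -ltnS.
apply: (@fill_holes _ _ V c sp (iota 0 t.+1) S) => //; first exact: iota_uniq.
  by move=> x /cV; rewrite mem_iota.
move=> j; rewrite mem_iota add0n ltnS /= => jt; rewrite cnt //.
move: jt; rewrite leq_eqVlt => /orP[/eqP->|jt]; first by rewrite su.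
by rewrite sh //; case: (avh _ jt).
Qed.

(** This is greedy filling: [r] units are poured into [t] bins of capacity [h], and bin [j] takes
    what it can of the amount left after [j] full bins. *)
Lemma sum_minn_mul h t r : r <= h * t -> \sum_(j < t) minn h (r - h * j) = r.
Proof.
elim: t r => [|t IH] r; first by rewrite muln0 leqn0 big_ord0 => /eqP->.
rewrite big_ord_recl muln0 subn0 /= mulnS => rt.
under eq_bigr => j _ do rewrite /bump /= add1n mulnS subnDA.
by rewrite IH ?leq_subLR // minnE; lia.
Qed.

(** Greedy filling leaves at most one hole of size [h] that is neither full nor empty, so few values
    of [avail h] are called for. *)
Lemma frame_spread h t u r v :
  frame h t u -> r <= h * t -> v <= u -> avail u v ->
  (forall j, j < t -> avail h (minn h (r - h * j))) ->
  avail (h * t + u) (r + v).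
Proof.
move=> F rt vu avu avh.
have := frame_avail (kf := fun j => if j < t then minn h (r - h * j) else v) F.
rewrite ltnn big_ord_recr /= ltnn; under eq_bigr => j _ do rewrite ltn_ord.
rewrite sum_minn_mul //; apply=> // j jt.
by rewrite jt; split; [exact: geq_minl | exact: avh].
Qed.

(** The hole of size [u] takes as many spouse pairs as it can hold. Since [h] is even, the number of
    remaining pairs is even, and so is the share of the only hole that is partly filled. *)
Lemma frame_universal h t u :
  frame h t u -> ~~ odd h -> universal h -> universal u ->
  universal (h * t + u).
Proof.
move=> F eh Uh Uu k kn ek.
have [ku|uk] := leqP k u.
  rewrite -[k]add0n; apply: (frame_spread F) => // [|j _].
    by apply: Uu; lia.
  by apply: Uh; lia.
rewrite -[k](subnK (ltnW uk)); apply: (frame_spread F) => //; first by lia.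
  by apply: Uu; rewrite // subnn.
move=> j jt; apply: Uh; first exact: geq_minl.
have eM i : ~~ odd (h * i) by rewrite oddM (negPf eh).
by move: (eM j) (eM t) kn ek; move: (h * j) (h * t) => x y; lia.
Qed.

(** When the last hole has received [u] spouse pairs, an even number remains. If it is 2 mod 4, two
    pairs are moved from the last hole to the others, so that a hole of size 4 is always full or
    empty. *)
Lemma frame4_universal t u :
  frame 4 t u -> avail 4 0 -> avail 4 4 -> 2 <= u -> universal u ->
  universal (4 * t + u).
Proof.
move=> F av0 av4 u2 Uu k kn ek.
have [ku|uk] := leqP k u.
  by rewrite -[k]add0n; apply: (frame_spread F) => //; apply: Uu; lia.
have av j r : 4 %| r -> avail 4 (minn 4 (r - 4 * j)).
  move=> /dvdnP[q ->]; rewrite [q * 4]mulnC -mulnBr.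
  by case: (q - j) => [|i]; rewrite ?muln0 // (minn_idPl _) // leq_pmulr.
have [d4|nd4] := boolP (4 %| k - u).
  rewrite -[k](subnK (ltnW uk)).
  apply: (frame_spread F) => // [||j _]; last exact: av.
    by lia.
  by apply: Uu; rewrite // subnn.
(* There is room for the two moved pairs: [k - u] is 2 mod 4 and at most [4 * t], hence at most
   [4 * t - 2]. *)
have -> : k = (k - u + 2) + (u - 2) by lia.
apply: (frame_spread F) => // [|||j _]; [lia | lia | | apply: av; lia].
by apply: Uu; lia.
Qed.

(** * Checking concrete sets of matches *)

Definition lexN (p q : N * N) :=
  (p.1 <? q.1)%num || (p.1 =? q.1)%num && (p.2 <=? q.2)%num.

Definition iotaN n : seq N := [seq N.of_nat i | i <- iota 0 n].

(** For an increasing [V] this list is already in lexicographic order, so sorting the actual pairs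
    and comparing decides the whole prescription at once. *)
Definition demand_list (V : seq N) (D : N -> N -> nat) :=
  flatten [seq nseq (D x y) (x, y) | x <- V, y <- V].

Definition meets_as (V : seq N) (D : meeting -> N -> N -> nat) S :=
  let ok r := sort lexN (all_pairs r S) == demand_list V (D r) in
  [&& ok Partners, ok OppMW, ok OppMM & ok OppWW].

Lemma iotaN_uniq n : uniq (iotaN n).
Proof. by rewrite map_inj_uniq ?iota_uniq //; apply: Nat2N.inj. Qed.

Lemma mem_iotaN n x : (x \in iotaN n) = (N.to_nat x < n).
Proof.
apply/mapP/idP => [[i]|xn]; first by rewrite mem_iota => ? ->; rewrite Nat2N.id.
by exists (N.to_nat x); rewrite ?mem_iota ?N2Nat.id.
Qed.

Lemma count_demand_list V D x y : uniq V ->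
  count_mem (x, y) (demand_list V D) = ((x \in V) && (y \in V)) * D x y.
Proof.
move=> uV; rewrite /demand_list count_flatten sumnE big_map big_allpairs_dep /=.
have cE a b : count_mem (x, y) (nseq (D a b) (a, b)) =
    (if a == x then (if b == y then D x y else 0) else 0).
  rewrite count_nseq /= xpair_eqE.
  by have [->|] := eqVneq a x; have [->|] := eqVneq b y; rewrite /= ?mul0n ?mul1n.
under eq_bigr => a _ do under eq_bigr => b _ do rewrite cE.
case Vx: (x \in V) => /=; last first.
  rewrite big_seq big1 // => a Va; case: eqP => [e|_]; last by rewrite big1.
  by rewrite e Vx in Va.
rewrite (bigD1_seq x) //= [X in _ + X]big1 => [|a /negPf->]; last by rewrite big1.
rewrite addn0 eqxx; case Vy: (y \in V) => /=; last first.
  rewrite big_seq big1 // => b Vb; case: eqP => [e|//].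
  by rewrite e Vy in Vb.
by rewrite (bigD1_seq y) //= eqxx big1 ?addn0 ?mul1n // => b /negPf->.
Qed.

(** Soundness rests only on the fact that [sort] permutes its argument; that [lexN] is an order
    matters just for the check to succeed. *)
Lemma meets_asP V D S : uniq V -> meets_as V D S ->
  forall r x y, meets S r x y = ((x \in V) && (y \in V)) * D r x y.
Proof.
move=> uV /and4P[chkP chkO chkM chkW] r x y; rewrite -count_demand_list //.
have /eqP <- : sort lexN (all_pairs r S) == demand_list V (D r) by case: r.
by apply/permP; rewrite perm_sym perm_sort.
Qed.

(** * Rotations of Z_g and labels of pairs *)

Definition rotate (g i x : N) : N :=
  if (x <? g)%num then (if x + i <? g then x + i else x + i - g)%num else x.

(* Rotation-invariant label of a pair; points x >= g are fixed by rotations, and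
   the junk value 0 marks pairs of fixed points. *)
Definition diff (g u x y : N) : N :=
  if (x <? g)%num then
    if (y <? g)%num then (if x <=? y then y - x else y + g - x)%num else y
  else if (y <? g)%num then (x + u)%num else 0%num.

Lemma sum_eq_iotaN n a (P : pred N) : (a < N.of_nat n)%num ->
  \sum_(i <- iotaN n) ((i == a) && P i) = P a.
Proof.
move=> an; rewrite (bigD1_seq a) ?iotaN_uniq ?mem_iotaN //=; last by lia.
by rewrite eqxx big1 ?addn0 // => i /negPf->.
Qed.

Lemma rotate_eq g i a x : (a < g -> x < g -> i < g ->
  (rotate g i a == x) = (i == if a <=? x then x - a else x + g - a))%num.
Proof.
move=> ag xg ig; rewrite /rotate.
by apply/eqP/eqP; do ?case: ifP; lia.
Qed.

Lemma rotate_inf g i a x : (i < g -> g <= a \/ g <= x ->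
  (rotate g i a == x) = (g <=? a) && (a == x))%num.
Proof.
move=> ig agx; rewrite /rotate.
case: N.ltb_spec => ag; case: N.leb_spec => //= ga; try lia.
by apply/eqP; case: ifP; lia.
Qed.

(** Rotations act freely on the pairs with at least one finite member, and [diff] separates their
    orbits: exactly one rotation carries [(a, b)] to [(x, y)] if the labels agree, and none
    otherwise. The label 0 is shared by the diagonal and the pairs of fixed points, so it is
    excluded for [(a, b)]. *)
Lemma sum_rotate n u a b x y : let g := N.of_nat n in
  (a < g + u)%num -> (b < g + u)%num -> (x < g + u)%num -> (y < g + u)%num ->
  diff g u a b <> 0%num -> (x < g)%num \/ (y < g)%num ->
  \sum_(i <- iotaN n) ((rotate g i a, rotate g i b) == (x, y)) =
  (diff g u a b == diff g u x y) :> nat.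
Proof.
move=> g agu bgu xgu ygu nz fin.
have ig i : i \in iotaN n -> (i < g)%num by rewrite mem_iotaN /g; lia.
(* If [a] is fixed then [b] is finite, and the rotation is determined by [b] and [y]. *)
have [ag|ga] := N.lt_ge_cases a g; last first.
  have bg : (b < g)%num by move: nz; rewrite /diff; do ?case: N.ltb_spec; lia.
  have [xg|gx] := N.lt_ge_cases x g.
    rewrite big_seq big1 => [|i /ig ig']; last first.
      by rewrite xpair_eqE rotate_inf; [case: eqP => /=; lia | done | left].
    by apply/esym/eqP; rewrite eqb0; apply/eqP; rewrite /diff; do ?case: ifP; lia.
  have yg : (y < g)%num by lia.
  have gyb : ((if b <=? y then y - b else y + g - b) < g)%num by case: ifP; lia.
  transitivity (\sum_(i <- iotaN n)
    ((i == if b <=? y then y - b else y + g - b)%num && (a == x))).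
    rewrite big_seq [RHS]big_seq; apply: eq_bigr => i /ig ig'.
    rewrite xpair_eqE rotate_inf //; last by left.
    by rewrite rotate_eq // andbC; case: N.leb_spec => //; lia.
  rewrite (@sum_eq_iotaN _ _ (fun=> a == x)) //; congr nat_of_bool.
  by apply/eqP/eqP; rewrite /diff; do ?case: ifP; lia.
(* A finite [a] is never rotated to a fixed [x]; if both are finite, the rotation is determined by
   them. *)
have [xg|gx] := N.lt_ge_cases x g; last first.
  rewrite big_seq big1 => [|i /ig ig']; last first.
    rewrite xpair_eqE rotate_inf; [|done|by right].
    by case: N.leb_spec => //=; lia.
  by apply/esym/eqP; rewrite eqb0; apply/eqP; rewrite /diff; do ?case: ifP; lia.
set i0 := (if a <=? x then x - a else x + g - a)%num.
have i0g : (i0 < g)%num by rewrite /i0; case: ifP; lia.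
transitivity (\sum_(i <- iotaN n) ((i == i0) && (rotate g i b == y))).
  rewrite big_seq [RHS]big_seq; apply: eq_bigr => i /ig ig'.
  by rewrite xpair_eqE rotate_eq.
rewrite (@sum_eq_iotaN _ _ (fun i => rotate g i b == y)) //; congr nat_of_bool.
by apply/eqP/eqP; rewrite /rotate /diff /i0; do ?case: ifP; lia.
Qed.

(** * Difference families *)

(** The holes are the residue classes mod [t] and the set of fixed points. There are [h * t + u.*2]
    labels: the differences below [g], then [u] labels for pairs ending in a fixed point and [u] for
    pairs starting with one. Each must occur once, except the multiples of [t] below [g], which
    belong to pairs inside a hole; the junk value 0 is among these. *)
Definition difference_ok h t u (base : seq (match_of N)) :=
  let g := N.of_nat (h * t) in let v := N.of_nat u in
  let ok r :=
    all (fun p => (p.1 <? g + v) && (p.2 <? g + v))%num (all_pairs r base) &&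
    (sort N.leb [seq diff g v p.1 p.2 | p <- all_pairs r base] ==
     [seq d <- iotaN (h * t + u.*2)
       | (g <=? d)%num || (d mod N.of_nat t != 0)%num]) in
  [&& ok Partners, ok OppMW, ok OppMM & ok OppWW].

Lemma count_modn_iota h t j :
  j < t -> count (fun x => x %% t == j) (iota 0 (h * t)) = h.
Proof.
move=> jt; elim: h => [|h IH] //.
rewrite mulSn addnC iotaD count_cat IH add0n -addn1; congr (_ + _).
rewrite -[X in iota X _]addn0 iotaDl count_map.
rewrite (eq_in_count (a2 := pred1 j)) => [|x].
  by rewrite count_uniq_mem ?iota_uniq // mem_iota jt.
by rewrite mem_iota => /andP[_ xt]; rewrite /= modnMDl modn_small.
Qed.

Lemma to_nat_mod x t : 0 < t -> N.to_nat (x mod N.of_nat t) = N.to_nat x %% t.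
Proof.
move=> t0; rewrite -(Nat2N.id (N.to_nat x %% t)); congr N.to_nat.
symmetry; apply: (N.mod_unique _ _ (N.of_nat (N.to_nat x %/ t))).
  by have := ltn_pmod (N.to_nat x) t0; lia.
by have := divn_eq (N.to_nat x) t; rewrite mulnC; lia.
Qed.

(** As [t] divides [h * t], reducing a difference mod [h * t] preserves its residue mod [t], so the
    label still tells whether two finite points share a hole. *)
Lemma diff_mod h t v x y : let g := N.of_nat (h * t) in
  0 < t -> (x < g)%num -> (y < g)%num ->
  ((diff g v x y mod N.of_nat t)%num == 0%num) =
  (N.to_nat x %% t == N.to_nat y %% t).
Proof.
move=> g t0 xg yg.
have -> : ((diff g v x y mod N.of_nat t)%num == 0%num) =
    (t %| N.to_nat (diff g v x y)).
  rewrite /dvdn -to_nat_mod //; apply/eqP/eqP => [->//|]; lia.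
rewrite /diff; have /N.ltb_lt-> := xg; have /N.ltb_lt-> := yg.
case: N.leb_spec => xy.
  by rewrite N2Nat.inj_sub [RHS]eq_sym eqn_mod_dvd //; lia.
rewrite (_ : N.to_nat (y + g - x) = h * t + N.to_nat y - N.to_nat x); last by lia.
by rewrite -eqn_mod_dvd ?modnMDl 1?eq_sym //; lia.
Qed.

(** When the base matches are developed under all rotations, [x] and [y] meet as often as the label
    of [(x, y)] occurs among the base pairs, and the check makes this 1 or 0 according to the
    holes. *)
Lemma cyclic_frame h t u base :
  0 < h -> 0 < t -> difference_ok h t u base -> frame h t u.
Proof.
move=> h0 t0 chk; have ht0 : 0 < h * t by rewrite muln_gt0 h0.
set g := N.of_nat (h * t); set v := N.of_nat u.
have {}chk r :
    all (fun p => (p.1 <? g + v) && (p.2 <? g + v))%num (all_pairs r base) /\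
    sort N.leb [seq diff g v p.1 p.2 | p <- all_pairs r base] =
    [seq d <- iotaN (h * t + u.*2)
      | (g <=? d)%num || (d mod N.of_nat t != 0)%num].
  case/and4P: chk => /andP[? /eqP ?] /andP[? /eqP ?] /andP[? /eqP ?].
  by case/andP=> ? /eqP ?; case: r.
pose c x := if (x <? g)%num then N.to_nat (x mod N.of_nat t) else t.
exists N, (iotaN (h * t + u)), c,
  (flatten [seq map (map_match (rotate g i)) base | i <- iotaN (h * t)]).
have cE i : c (N.of_nat i) = if i < h * t then i %% t else t.
  rewrite /c /g to_nat_mod // Nat2N.id.
  by case: N.ltb_spec; case: ltnP => //; lia.
have cN x : (x < g)%num -> c x = N.to_nat x %% t.
  by move=> xg; rewrite -{1}[x]N2Nat.id cE; case: ltnP => //; lia.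
have cI x : (g <= x)%num -> c x = t.
  by move=> xg; rewrite -{1}[x]N2Nat.id cE; case: ltnP => //; lia.
have cnt j : count (fun x => c x == j) (iotaN (h * t + u)) =
    count (fun x => x %% t == j) (iota 0 (h * t)) + (t == j) * u.
  rewrite count_map iotaD count_cat; congr (_ + _).
    by apply: eq_in_count => i; rewrite mem_iota /= add0n cE => ->.
  rewrite (eq_in_count (a2 := fun=> t == j)) => [|i]; last first.
    by rewrite mem_iota add0n /= cE => /andP[ti _]; rewrite ltnNge ti.
  by case: (t == j); rewrite ?count_predT ?count_pred0 ?size_iota ?mul1n.
split; rewrite ?iotaN_uniq //.
- move=> x _; rewrite /c; case: ifP => // _.
  by rewrite to_nat_mod // ltnW // ltn_pmod.
- move=> r x y; have [/allP lt dE] := chk r.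
  rewrite meets_flatten !mem_iotaN.
  pose P := all_pairs r base.
  (* The sums over rotations and over base pairs are exchanged; the inner sum is then the one of
     [sum_rotate]. *)
  transitivity (\sum_(p <- P) \sum_(i <- iotaN (h * t))
      ((rotate g i p.1, rotate g i p.2) == (x, y))).
    rewrite exchange_big; apply: eq_bigr => i _.
    by rewrite /meets all_pairs_map count_map -sum1_count big_mkcond.
  have ltP p : p \in P -> (p.1 < g + v)%num /\ (p.2 < g + v)%num.
    by move=> /lt/andP[]; do 2!case: N.ltb_spec => //.
  (* The expected labels omit 0, which is below [g] and a multiple of [t]. *)
  have nz p : p \in P -> diff g v p.1 p.2 <> 0%num.
    move=> Pp dp; have : 0%num \in sort N.leb [seq diff g v p.1 p.2 | p <- P].
      by rewrite mem_sort -dp; apply/mapP; exists p.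
    rewrite dE mem_filter N.Div0.mod_0_l eqxx orbF.
    by case: N.leb_spec => //; lia.
  have igi i : i \in iotaN (h * t) -> (i < g)%num by rewrite mem_iotaN /g; lia.
  (* The only pairs that can occur consist of two players, at least one of them finite. For all
     others the count is 0, since rotations preserve the set of players and the set of finite
     points. *)
  have [inside|outside] := boolP [&& (x <? g + v)%num, (y <? g + v)%num &
      (x <? g)%num || (y <? g)%num].
    have [/N.ltb_spec0 xgv /N.ltb_spec0 ygv /orP fin] := and3P inside.
    have {}fin : (x < g)%num \/ (y < g)%num by case: fin => /N.ltb_spec0; auto.
    transitivity (count_mem (diff g v x y) [seq diff g v p.1 p.2 | p <- P]).
      rewrite count_map -sum1_count [RHS]big_mkcond big_seq [RHS]big_seq.
      apply: eq_bigr => p Pp; have [p1 p2] := ltP p Pp.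
      by rewrite (@sum_rotate _ v) //; exact: nz.
    rewrite -(permP (permEl (perm_sort N.leb _))) dE.
    rewrite count_uniq_mem ?filter_uniq ?iotaN_uniq // mem_filter mem_iotaN.
    have xn : N.to_nat x < h * t + u by lia.
    have yn : N.to_nat y < h * t + u by lia.
    rewrite xn yn /=.
    have [xg|gx] := N.lt_ge_cases x g; have [yg|gy] := N.lt_ge_cases y g;
      last by lia.
    - have dg : (diff g v x y < g)%num by rewrite /diff; do ?case: ifP; lia.
      rewrite diff_mod // !cN //; case: N.leb_spec => /= [|_]; first by lia.
      have -> : N.to_nat (diff g v x y) < h * t + u.*2 by lia.
      by rewrite andbT.
    - rewrite (cI y) // cN //.
      have -> : diff g v x y = y by rewrite /diff; do ?case: ifP; lia.
      have -> : N.to_nat y < h * t + u.*2 by lia.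
      by rewrite (ltn_eqF (ltn_pmod _ t0)); case: N.leb_spec => //; lia.
    - rewrite (cI x) // cN // gtn_eqF ?ltn_pmod //.
      have -> : diff g v x y = (x + v)%num by rewrite /diff; do ?case: ifP; lia.
      have -> : N.to_nat (x + v) < h * t + u.*2 by lia.
      by case: N.leb_spec => //; lia.
  rewrite big_seq big1 => [|p Pp]; last first.
    have [p1 p2] := ltP p Pp; have pz := nz p Pp.
    rewrite big_seq big1 // => i /igi ig.
    apply/eqP; rewrite eqb0; apply: contra outside => /eqP[<- <-].
    have rg z : (z < g + v)%num ->
        (rotate g i z <? g + v)%num /\ (rotate g i z <? g)%num = (z <? g)%num.
      by rewrite /rotate; case: (N.ltb_spec z g) => zg zgv;
        [case: ifP => ?; split; apply/N.ltb_spec0 | split; [|apply/N.ltb_spec0]];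
        lia.
    have [-> ->] := rg _ p1; have [-> ->] := rg _ p2.
    move: pz; rewrite /diff; case: (_ <? g)%num => //.
    by case: (_ <? g)%num.
  move: outside; case: N.ltb_spec => /= xgv; last first.
    have -> // : N.to_nat x < h * t + u = false by lia.
  case: N.ltb_spec => /= ygv; last first.
    have -> : N.to_nat y < h * t + u = false by lia.
    by rewrite andbF.
  case: N.ltb_spec => //= gx; case: N.ltb_spec => //= gy _.
  by rewrite !cI // eqxx !andbF.
- by move=> j jt; rewrite size_filter cnt count_modn_iota // gtn_eqF ?addn0.
- rewrite size_filter cnt eqxx mul1n (eq_in_count (a2 := pred0)) => [|x _].
    by rewrite count_pred0.
  by rewrite /= ltn_eqF // ltn_pmod.
Qed.

(** * Transversal designs *)

Definition hole_size (h t u i : nat) := if i < t then h else u.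

(** Renaming the points by hole and rank gives frames with different last holes a common system of
    names, so that they can be superposed along the blocks of a design. *)
Lemma frame_coord h t u : 0 < h -> 0 < t -> frame h t u ->
  exists S : seq (match_of (nat * nat)), forall r x y,
    meets S r x y =
    [&& (x.1 <= t) && (x.2 < hole_size h t u x.1),
        (y.1 <= t) && (y.2 < hole_size h t u y.1) & x.1 != y.1].
Proof.
move=> h0 t0 [T [V [c [S [uV cV SP sh su]]]]].
pose cls i := [seq x <- V | c x == i].
have scls i : i <= t -> size (cls i) = hole_size h t u i.
  by rewrite leq_eqVlt /hole_size => /orP[/eqP->|it]; rewrite ?ltnn ?su ?it ?sh.
(* A point of the first hole serves as default value of [nth]; it exists because [h] and [t] are
   positive. *)
have [x0 _] : exists x0, x0 \in cls 0.
  case E: (cls 0) => [|x0 s]; last by exists x0; rewrite mem_head.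
  by move: (sh _ t0) h0; rewrite -/(cls 0) E => <-.
pose f x := (c x, index x (cls (c x))).
pose g (p : nat * nat) := nth x0 (cls p.1) p.2.
have fK x : x \in V -> g (f x) = x.
  by move=> Vx; rewrite /g /f nth_index // mem_filter eqxx.
have SV r p : p \in all_pairs r S -> p.1 \in V /\ p.2 \in V.
  case: p => x y; rewrite -has_pred1 has_count -/(meets S r x y) SP /=.
  by do 2!case: (_ \in V).
have gP p : (f (g p) == p) && (g p \in V) =
    (p.1 <= t) && (p.2 < hole_size h t u p.1).
  case: p => i r /=; apply/andP/andP => [[/eqP[ci ir] Vg]|[it ri]].
    have it : i <= t by rewrite -ci cV.
    have : index (g (i, r)) (cls (c (g (i, r)))) < size (cls (c (g (i, r)))).
      by rewrite index_mem mem_filter eqxx.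
    by rewrite ir ci scls.
  have : g (i, r) \in cls i by rewrite mem_nth // scls.
  rewrite mem_filter => /andP[/eqP ci Vg]; split=> //.
  by rewrite /f ci /g /= index_uniq ?eqxx ?scls // filter_uniq.
exists (map (map_match f) S) => r x y.
rewrite (@meets_map _ _ f g) => [|p /SV[? ?]]; last by rewrite !fK.
rewrite SP mulnb; congr nat_of_bool; rewrite -!gP.
case: eqP => [fx|_] //=; case: eqP => [fy|_] //=; last by rewrite andbF.
by rewrite -[in RHS]fx -[in RHS]fy /= fx fy.
Qed.

Import GRing.Theory.
Local Open Scope ring_scope.

(* Blocks of the transversal design are the lines v = a i + b restricted to
   i < 4, completed by the slope [a] as a point of the fifth group. *)
Definition line (R : nzRingType) (ab : R * R) (i : nat) : R :=
  if (i < 4)%N then ab.1 * i%:R + ab.2 else ab.1.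

(** Two points of different groups determine the line: the slope is found by dividing by [j - i],
    which is 1, 2 or 3, and a point of the fifth group is the slope itself. The intercept
    follows. *)
Lemma line_inj (R : comUnitRingType) (i j : nat) :
  (forall d, (0 < d < 4)%N -> (d%:R : R) \is a GRing.unit) ->
  (i <= 4)%N -> (j <= 4)%N -> i != j ->
  injective (fun ab : R * R => (line ab i, line ab j)).
Proof.
move=> un i4 j4 nij.
wlog ij : i j i4 j4 nij / (i < j)%N => [IH|].
  case: (ltngtP i j) nij => // ij _; first by apply: IH => //; rewrite ltn_eqF.
  move=> x y [e1 e2]; apply: (IH j i) => //; first by rewrite ltn_eqF.
  by rewrite e1 e2.
move=> [a b] [a' b'] [] /=; rewrite /line (leq_trans ij) //=.
case: ltnP => j4' => [e1 e2|e1 ea]; last first.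
  by move: e1; rewrite ea => /addrI ->.
have ea : a = a'.
  apply: (mulIr (un (j - i)%N _)); first by lia.
  rewrite natrB ?(ltnW ij) // !mulrBr; apply/eqP.
  rewrite -subr_eq0 -(subrr (a * j%:R + b - (a * i%:R + b))) {2}e1 {2}e2.
  apply/eqP.
  by rewrite !opprB !opprD; ring.
by move: e1; rewrite ea => /addrI ->.
Qed.

(** A point of the first four groups is replaced by [w] copies and a point [v] of the fifth by
    [wt v] copies; the block with slope [a] carries a frame of type [w^4 (wt a)^1] whose holes are
    the copies of its five points. Points over different groups meet on the unique block through
    them, points over the same group never meet, and so the groups become the holes. *)
Lemma transversal_frame (R : finComUnitRingType) (w u : nat) (wt : R -> nat) :
  (forall d, (0 < d < 4)%N -> (d%:R : R) \is a GRing.unit) -> (0 < w)%N ->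
  (forall a, frame w 4 (wt a)) -> (\sum_a wt a)%N = u ->
  frame (w * #|R|) 4 u.
Proof.
move=> un w0 fr su.
have [S SP] := fin_all_exists (fun a => @frame_coord w 4 (wt a) w0 isT (fr a)).
pose W (i : nat) v := if (i < 4)%N then w else wt v.
(* Hole [p.1] of the small frame is placed on the copies of the point where block [ab] meets group
   [p.1]; [g] forgets which point that was. *)
pose f (ab : R * R) (p : nat * nat) := ((p.1, line ab p.1), p.2).
pose g (q : nat * R * nat) := (q.1.1, q.2).
pose grp := [seq (i, v) | i <- iota 0 5, v <- enum R].
pose V := [seq (p, r) | p <- grp, r <- iota 0 (W p.1 p.2)].
have ugrp : uniq grp.
  by rewrite allpairs_uniq ?iota_uniq ?enum_uniq // => -[? ?] [? ?] _ _ [-> ->].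
have uV : uniq V.
  apply: allpairs_uniq_dep => // [p _|]; first exact: iota_uniq.
  by move=> [p r] [p' r'] _ _ /= [-> ->].
have memV q : (q \in V) = (q.1.1 <= 4)%N && (q.2 < W q.1.1 q.1.2)%N.
  case: q => -[i v] r /=; apply/allpairsPdep/andP.
    move=> [p [r' [/allpairsPdep[i' [v' [i4 _ ->]]] rW [-> -> ->]]]] /=.
    by move: i4 rW; rewrite !mem_iota.
  move=> [i4 rW]; exists (i, v), r; split; rewrite ?mem_iota //.
  by apply/allpairsPdep; exists i, v; split; rewrite ?mem_iota ?mem_enum.
have sz j : (j <= 4)%N -> size [seq x <- V | x.1.1 == j] = (\sum_v W j v)%N.
  move=> j4; pose C := [seq ((j, v), r) | v <- enum R, r <- iota 0 (W j v)].
  have -> : (\sum_v W j v)%N = size C.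
    rewrite size_allpairs_dep sumnE big_map big_enum /=.
    by apply: eq_bigr => v _; rewrite size_iota.
  apply/perm_size/uniq_perm; first exact: filter_uniq.
    apply: allpairs_uniq_dep => [|v _|[v r] [v' r'] _ _ /= [-> ->] //].
      exact: enum_uniq.
    exact: iota_uniq.
  move=> [[i v] r]; rewrite mem_filter memV /=.
  apply/andP/allpairsPdep => [[/eqP-> /andP[_ rW]]|[v' [r' [_ rW [-> -> ->]]]]].
    by exists v, r; rewrite mem_enum mem_iota.
  by rewrite eqxx j4 /=; move: rW; rewrite mem_iota.
exists (nat * R * nat)%type, V, (fun q => q.1.1),
  (flatten [seq map (map_match (f ab)) (S ab.1) | ab <- enum {: R * R}]).
split=> //.
- by move=> x; rewrite memV => /andP[].
- move=> r x y; rewrite meets_flatten big_enum /=.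
  have fg ab q : (f ab (g q) == q) = (line ab q.1.1 == q.1.2).
    by case: q => -[i v] k; rewrite /f /g /= !xpair_eqE !eqxx andbT.
  pose cond := [&& x \in V, y \in V & x.1.1 != y.1.1].
  transitivity (\sum_ab
      cond * ((line ab x.1.1, line ab y.1.1) == (x.1.2, y.1.2)))%N.
    apply: eq_bigr => ab _.
    rewrite (@meets_map _ _ (f ab) g) => [|[[i k] [i' k']] _]; last by [].
    rewrite !fg SP xpair_eqE /cond !memV /W /hole_size /= !mulnb.
    congr nat_of_bool; rewrite [RHS]andbC.
    (* For points on the block the ranges of copies agree: in the fifth group the point is the slope
       [ab.1], whose weight is the last hole of the frame used. *)
    case: eqP => [<-|_]; rewrite ?andbF //; case: eqP => [<-|_];
      rewrite ?andbF // !andbT /line.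
    by case: (x.1.1 < 4)%N; case: (y.1.1 < 4)%N.
  rewrite -big_distrr /= /cond; case: eqVneq => [_|nij].
    by rewrite !andbF mul0n.
  rewrite !memV; case: (leqP x.1.1 4) => // i4.
  case: (leqP y.1.1 4) => [j4|]; last by rewrite ?andbF.
  (* As [R * R] is finite, injectivity also yields the existence of a block through the two points,
     and only this block contributes to the sum. *)
  have [G GK FK] := injF_bij (line_inj un i4 j4 nij).
  rewrite (bigD1 (G (x.1.2, y.1.2))) //= FK eqxx big1 ?muln1 // => ab /eqP nab.
  by case: eqP => // e; case: nab; rewrite -e GK.
- by move=> j j4; rewrite sz ?(ltnW j4) // /W j4 sum_nat_const mulnC.
by rewrite sz // -su.
Qed.

Local Close Scope ring_scope.
Local Open Scope N_scope.

(** * Computer data *)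

Definition difference_family :=
  (nat * nat * seq (N * N * N) * seq (N * N) * seq (N * N))%type.

(* With infinite points [g + i], a triple (c, b, d) encodes M_0 F_b v M_c F_d,
   the i-th pair (c, d) of [iw] encodes M_0 F_(g+i) v M_c F_d, and the i-th pair
   (b, d) of [im] encodes M_(g+i) F_b v M_0 F_d. *)
Definition base_matches (g : N) (fin : seq (N * N * N)) (iw im : seq (N * N)) :
    seq (match_of N) :=
  [seq let: (c, b, d) := q in ((0, b), (c, d)) | q <- fin] ++
  [seq let: (i, (c, d)) := q in ((0, g + i), (c, d))
    | q <- zip (iotaN (size iw)) iw] ++
  [seq let: (i, (b, d)) := q in ((g + i, b), (0, d))
    | q <- zip (iotaN (size im)) im].

(* A row (t, u, fin, iw, im) yields a frame of type 4^t u^1. *)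
Definition families4 : seq difference_family :=
[::
 (5%nat, 7%nat, [:: (1,2,19)], [:: (11,3); (12,8); (13,17); (14,2); (4,18);
  (17,16); (2,11)], [:: (6,17); (13,1); (4,11); (12,6); (7,3); (9,7); (14,13)]);
 (5%nat, 8%nat, [::], [:: (9,2); (12,11); (13,7); (14,18); (16,17); (3,19);
  (18,16); (19,6)], [:: (12,3); (3,11); (13,6); (14,8); (1,17); (9,12); (4,2);
  (8,9)]);
 (6%nat, 7%nat, [:: (8,7,22); (10,1,3); (20,10,9)], [:: (11,16); (9,20);
  (17,8); (19,17); (3,2); (2,21); (23,1)], [:: (19,8); (10,20); (5,21); (11,4);
  (4,9); (7,3); (13,16)]);
 (6%nat, 8%nat, [:: (5,14,4); (20,10,3)], [:: (13,5); (10,23); (15,2); (16,17);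
  (17,13); (3,22); (2,7); (23,21)], [:: (15,2); (8,17); (20,4); (16,21);
  (19,15); (11,8); (1,3); (10,9)]);
 (6%nat, 9%nat, [:: (1,14,3)], [:: (13,21); (14,7); (15,22); (16,17); (17,2);
  (19,10); (4,23); (3,14); (22,19)], [:: (9,23); (1,16); (20,4); (15,22);
  (5,10); (16,20); (8,5); (11,13); (4,3)]);
 (6%nat, 10%nat, [::], [:: (13,23); (10,3); (15,20); (16,11); (17,9); (19,10);
  (4,17); (3,14); (2,4); (23,21)], [:: (22,9); (15,1); (19,4); (5,21); (7,14);
  (13,8); (16,20); (2,23); (1,3); (8,7)]);
 (7%nat, 7%nat, [:: (3,19,15); (9,11,10); (6,17,26); (11,15,9); (5,25,27)], [::
  (13,22); (16,19); (18,17); (8,3); (24,12); (2,6); (27,23)], [:: (25,10);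
  (18,2); (1,18); (24,6); (5,13); (13,8); (8,5)]);
 (7%nat, 8%nat, [:: (3,19,15); (9,11,10); (6,17,26); (4,8,20)], [:: (13,12);
  (16,19); (11,17); (10,6); (20,18); (5,23); (26,8); (1,24)], [:: (22,9);
  (5,22); (3,13); (13,5); (9,15); (25,2); (1,4); (27,25)]);
 (7%nat, 9%nat, [:: (3,19,15); (9,11,10); (6,17,26)], [:: (13,23); (12,18);
  (11,27); (10,8); (8,17); (5,9); (24,20); (26,6); (1,4)], [:: (12,25);
  (25,13); (22,5); (5,15); (3,23); (24,2); (13,18); (19,22); (1,27)]);
 (7%nat, 10%nat, [:: (22,23,18); (17,22,6)], [:: (15,25); (12,4); (10,15);
  (19,27); (20,10); (5,11); (4,8); (25,12); (26,9); (1,13)], [:: (3,16);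
  (20,9); (23,13); (16,25); (19,27); (24,2); (22,26); (26,1); (17,19); (2,3)]);
 (8%nat, 7%nat, [:: (14,13,18); (15,5,25); (5,2,3); (22,28,7); (11,26,30);
  (12,7,5); (2,14,20)], [:: (19,10); (23,13); (25,28); (26,23); (4,19); (3,9);
  (31,26)], [:: (4,21); (17,31); (1,20); (11,1); (21,12); (2,9); (14,11)]);
 (8%nat, 10%nat, [:: (14,13,18); (31,1,20); (5,2,3); (4,5,14)], [:: (17,12);
  (13,19); (12,30); (21,9); (22,7); (9,21); (7,10); (6,5); (29,22); (30,27)],
  [:: (13,28); (23,9); (6,26); (26,15); (17,7); (4,11); (28,22); (15,19);
  (11,14); (25,23)]);
 (9%nat, 7%nat, [:: (7,11,28); (4,14,17); (10,12,20); (16,5,3); (19,33,8);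
  (2,26,21); (3,16,1); (12,28,5); (15,8,30)], [:: (22,6); (13,35); (11,15);
  (28,23); (30,32); (5,22); (35,34)], [:: (12,32); (19,7); (11,1); (31,24);
  (33,3); (26,30); (7,6)]);
 (9%nat, 8%nat, [:: (7,11,28); (14,20,10); (10,12,20); (16,5,3); (19,33,8);
  (2,26,21); (8,6,22); (12,28,5)], [:: (15,17); (23,11); (25,32); (6,19);
  (31,26); (32,33); (33,12); (1,35)], [:: (31,16); (30,8); (15,3); (1,30);
  (29,35); (13,17); (7,4); (23,22)]);
 (9%nat, 9%nat, [:: (7,11,28); (4,14,17); (10,12,20); (16,5,3); (19,33,8);
  (2,26,21); (3,16,1)], [:: (21,23); (14,29); (23,19); (12,11); (25,32);
  (28,22); (6,26); (31,12); (35,30)], [:: (6,22); (15,1); (31,8); (16,28);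
  (34,24); (33,4); (35,29); (7,3); (5,6)]);
 (9%nat, 10%nat, [:: (7,11,28); (4,14,17); (10,12,20); (16,5,3); (19,33,8);
  (2,26,21)], [:: (15,23); (14,31); (13,16); (24,22); (25,13); (28,32); (6,1);
  (5,33); (33,26); (35,15)], [:: (12,32); (7,22); (29,15); (30,7); (6,30);
  (11,1); (35,6); (5,35); (34,2); (19,20)]);
 (11%nat, 7%nat, [:: (4,6,16); (10,5,13); (25,30,12); (13,42,3); (42,40,15);
  (6,27,7); (41,20,26); (14,23,6); (18,37,34); (1,15,36); (29,39,4); (8,2,32);
  (20,28,27)], [:: (21,20); (27,35); (16,25); (12,30); (9,41); (7,17);
  (39,43)], [:: (37,21); (40,25); (28,41); (1,13); (31,38); (18,14); (24,26)]);
 (11%nat, 8%nat, [:: (21,5,34); (8,34,24); (25,30,12); (16,3,1); (42,40,15);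
  (6,27,7); (10,37,16); (14,23,6); (18,20,17); (31,24,25); (29,39,4);
  (9,41,13)], [:: (24,38); (17,35); (32,30); (7,14); (39,20); (4,39); (41,43);
  (1,29)], [:: (40,10); (8,21); (41,9); (23,15); (19,26); (18,12); (3,8);
  (36,32)]);
 (11%nat, 9%nat, [:: (5,8,23); (20,38,8); (25,30,12); (12,13,41); (42,40,15);
  (6,27,7); (34,28,16); (14,23,6); (18,37,34); (1,15,36); (29,39,4)], [::
  (23,28); (27,31); (16,26); (13,25); (35,37); (36,39); (37,43); (4,13);
  (3,2)], [:: (27,14); (17,7); (29,21); (35,42); (30,24); (20,25); (24,20);
  (32,34); (40,41)]);
 (11%nat, 10%nat, [:: (5,8,23); (20,38,8); (25,30,12); (12,13,41); (42,40,15);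
  (6,27,7); (34,28,16); (14,23,6); (18,37,34); (1,15,36)], [:: (23,35);
  (17,31); (16,26); (29,24); (31,40); (35,39); (36,17); (7,13); (4,25);
  (41,2)], [:: (20,7); (32,42); (28,19); (10,2); (27,20); (37,43); (29,24);
  (30,34); (43,41); (4,3)]);
 (12%nat, 7%nat, [:: (19,6,33); (17,13,21); (25,41,10); (38,3,6); (2,22,41);
  (16,31,17); (7,45,1); (39,23,34); (15,18,2); (1,46,28); (18,25,23);
  (14,9,31); (5,30,37); (8,37,4); (28,2,27)], [:: (22,30); (27,19); (13,39);
  (11,40); (6,26); (4,42); (3,14)], [:: (8,28); (47,34); (11,21); (46,7);
  (9,15); (5,10); (18,19)]);
 (12%nat, 8%nat, [:: (19,6,33); (37,19,44); (25,41,10); (38,3,6); (2,22,41);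
  (16,31,17); (7,45,1); (39,23,34); (15,18,2); (1,46,28); (18,25,23);
  (21,29,42); (5,30,37); (8,37,4)], [:: (26,39); (20,40); (31,21); (14,18);
  (35,46); (42,11); (44,43); (3,31)], [:: (14,40); (22,2); (19,9); (47,8);
  (26,34); (9,15); (5,10); (27,26)]);
 (12%nat, 9%nat, [:: (19,6,33); (17,13,21); (25,41,10); (38,3,6); (2,22,41);
  (16,31,17); (7,45,1); (39,23,34); (15,18,2); (1,46,28); (18,25,23);
  (14,9,31); (5,30,37)], [:: (26,22); (27,42); (20,9); (35,27); (37,47);
  (40,11); (42,5); (44,4); (3,29)], [:: (30,7); (18,38); (14,29); (8,21);
  (40,2); (19,28); (26,20); (39,34); (46,47)]);
 (12%nat, 10%nat, [:: (19,6,33); (17,13,21); (25,41,10); (38,3,6); (2,22,41);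
  (16,31,17); (7,45,1); (39,23,34); (15,18,2); (1,46,28); (18,25,23);
  (14,9,31)], [:: (26,25); (21,29); (28,9); (35,8); (11,26); (8,19); (42,22);
  (43,39); (44,30); (45,27)], [:: (14,37); (46,26); (5,38); (42,7); (40,2);
  (11,20); (47,40); (4,10); (37,32); (18,19)]);
 (13%nat, 7%nat, [:: (6,7,9); (19,1,33); (16,40,51); (20,34,6); (2,32,31);
  (10,51,29); (22,41,44); (12,9,28); (34,37,12); (43,6,48); (17,44,32);
  (24,49,35); (5,25,17); (7,47,38); (23,17,21); (4,27,22); (37,21,5)], [::
  (27,11); (31,2); (14,42); (41,43); (8,4); (3,7); (1,47)], [:: (37,8);
  (45,24); (8,42); (10,45); (18,33); (50,43); (16,10)]);
 (13%nat, 8%nat, [:: (8,4,11); (19,1,33); (3,6,43); (20,34,6); (2,32,31);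
  (10,51,29); (22,41,44); (12,9,28); (15,30,9); (9,8,42); (17,44,32);
  (11,35,8); (5,25,17); (7,47,38); (23,17,21); (4,27,22)], [:: (27,37); (28,4);
  (21,12); (34,45); (36,5); (14,50); (46,36); (51,47)], [:: (25,2); (2,37);
  (7,23); (10,24); (16,5); (35,45); (1,7); (18,20)]);
 (13%nat, 9%nat, [:: (6,7,9); (19,1,33); (37,30,47); (20,34,6); (2,32,31);
  (10,51,29); (22,41,44); (12,9,28); (44,48,12); (9,8,42); (17,44,32);
  (24,49,35); (5,25,17); (7,47,38); (23,17,21)], [:: (25,15); (31,36); (34,5);
  (16,10); (14,7); (11,2); (4,22); (3,24); (1,37)], [:: (8,35); (50,27);
  (16,37); (3,40); (43,2); (48,6); (11,4); (18,24); (23,28)]);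
 (13%nat, 10%nat, [:: (6,7,9); (19,34,23); (14,50,7); (7,18,45); (2,32,31);
  (10,51,29); (22,41,44); (12,9,28); (37,43,38); (9,8,42); (17,44,32);
  (24,49,35); (5,25,17); (1,47,43)], [:: (25,3); (29,34); (31,48); (20,16);
  (34,5); (16,18); (41,10); (8,2); (48,24); (49,21)], [:: (8,36); (33,10);
  (4,35); (40,20); (14,31); (50,14); (22,37); (37,27); (47,40); (12,6)]);
 (14%nat, 7%nat, [:: (19,6,37); (22,40,44); (9,3,53); (15,35,25); (44,45,46);
  (21,27,30); (11,20,22); (25,49,29); (6,51,38); (5,21,55); (32,43,17);
  (36,34,27); (17,52,33); (49,25,41); (2,38,3); (18,30,47); (13,15,10);
  (10,23,8); (30,37,5)], [:: (27,26); (33,23); (16,40); (48,4); (4,21); (3,39);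
  (1,34)], [:: (48,19); (49,26); (31,13); (51,39); (19,8); (52,5); (15,7)]);
 (14%nat, 8%nat, [:: (43,47,40); (29,17,9); (1,7,34); (15,35,25); (44,45,46);
  (24,18,30); (52,11,22); (25,49,29); (6,51,38); (5,21,55); (20,46,51);
  (11,8,31); (17,52,33); (49,25,41); (2,38,3); (18,30,47); (19,12,43);
  (10,23,8)], [:: (26,7); (33,17); (34,5); (35,54); (40,27); (9,18); (8,11);
  (3,2)], [:: (39,13); (10,34); (23,41); (52,5); (21,15); (48,44); (19,22);
  (37,39)]);
 (14%nat, 9%nat, [:: (19,6,37); (29,17,9); (1,7,34); (15,35,25); (44,45,46);
  (16,9,21); (52,11,22); (25,49,29); (6,51,38); (5,21,55); (32,43,17);
  (11,8,31); (17,52,33); (49,25,41); (2,38,3); (18,30,47); (13,15,10)], [::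
  (30,52); (23,54); (22,13); (35,23); (20,4); (10,8); (47,30); (48,5); (3,26)],
  [:: (51,19); (50,12); (19,34); (18,27); (48,55); (40,46); (7,3); (27,24);
  (39,37)]);
 (14%nat, 10%nat, [:: (19,6,37); (29,17,9); (1,7,34); (15,35,25); (44,45,46);
  (16,9,21); (52,11,22); (25,49,29); (6,51,38); (5,21,55); (32,43,17);
  (11,8,31); (17,52,33); (49,25,41); (2,38,3); (18,30,47)], [:: (30,54);
  (23,26); (34,5); (35,23); (20,10); (43,2); (46,13); (9,48); (8,7); (53,51)],
  [:: (8,40); (30,12); (4,19); (40,31); (27,34); (19,13); (52,47); (18,22);
  (50,53); (39,37)]);
 (15%nat, 7%nat, [:: (17,6,13); (53,58,39); (28,29,32); (51,43,29); (49,37,6);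
  (23,33,37); (19,47,31); (24,35,43); (4,11,9); (38,36,27); (29,3,38);
  (42,1,55); (14,39,22); (44,48,24); (12,26,36); (47,41,46); (20,28,51);
  (27,2,20); (52,55,42); (6,32,33); (10,22,2)], [:: (34,41); (25,59); (21,18);
  (55,16); (3,57); (58,40); (59,17)], [:: (23,51); (53,20); (50,16); (47,25);
  (44,23); (56,44); (21,10)]);
 (15%nat, 8%nat, [:: (21,18,44); (53,58,39); (28,29,32); (20,38,16); (49,37,6);
  (23,33,37); (19,47,31); (24,35,43); (22,34,27); (26,16,2); (14,3,23);
  (42,1,55); (1,57,22); (44,48,24); (12,26,36); (47,41,46); (10,31,52);
  (27,2,20); (57,50,17); (6,32,33)], [:: (31,25); (25,8); (43,34); (51,13);
  (8,47); (55,3); (56,40); (58,9)], [:: (38,6); (29,52); (42,25); (41,28);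
  (7,55); (59,10); (58,7); (51,49)]);
 (15%nat, 9%nat, [:: (17,6,13); (53,58,39); (28,29,32); (51,43,29); (49,37,6);
  (23,33,37); (19,47,31); (24,35,43); (4,11,9); (38,36,27); (29,3,38);
  (42,1,55); (14,39,22); (44,48,24); (12,26,36); (47,41,46); (20,28,40);
  (27,2,20); (52,55,42)], [:: (26,57); (25,41); (39,33); (10,17); (54,12);
  (5,47); (3,26); (58,23); (59,51)], [:: (53,21); (59,32); (44,10); (21,44);
  (56,34); (18,57); (2,22); (16,27); (50,51)]);
 (15%nat, 10%nat, [:: (17,6,13); (53,58,39); (28,29,32); (51,43,29); (49,37,6);
  (23,33,37); (19,47,31); (24,35,43); (4,11,9); (38,36,27); (2,48,12);
  (26,42,53); (14,39,22); (6,3,38); (12,26,36); (10,52,19); (20,28,40);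
  (27,2,20)], [:: (29,51); (25,59); (21,44); (42,3); (44,34); (47,41); (8,33);
  (5,21); (57,56); (59,50)], [:: (23,55); (47,13); (4,41); (2,40); (18,57);
  (24,44); (54,7); (55,1); (26,31); (17,18)]);
 (16%nat, 7%nat, [:: (21,4,59); (20,12,23); (30,56,52); (10,45,9); (23,2,37);
  (37,18,63); (9,21,20); (5,15,28); (15,19,1); (57,42,44); (29,43,18);
  (17,13,7); (42,24,38); (18,29,24); (2,27,54); (4,25,13); (11,61,51);
  (24,17,61); (26,57,8); (6,8,39); (3,36,62); (1,28,36); (50,20,17)], [::
  (31,22); (28,29); (25,30); (19,53); (51,58); (12,42); (8,55)], [:: (40,10);
  (15,39); (3,44); (19,41); (6,49); (41,58); (5,62)]);
 (16%nat, 8%nat, [:: (21,4,59); (20,12,23); (30,56,52); (1,35,21); (23,2,37);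
  (37,18,63); (24,29,12); (5,15,28); (15,19,1); (57,42,44); (8,33,55);
  (17,13,7); (25,34,6); (2,44,39); (18,11,3); (12,39,40); (11,61,51);
  (58,55,18); (26,57,8); (51,53,30); (3,36,62); (29,1,35)], [:: (33,54);
  (36,46); (22,29); (45,22); (14,19); (54,20); (55,53); (4,13)], [:: (58,25);
  (38,63); (41,17); (17,60); (14,58); (15,27); (24,31); (11,8)]);
 (16%nat, 9%nat, [:: (21,4,59); (20,12,23); (30,56,52); (10,45,9); (23,2,37);
  (37,18,63); (24,29,12); (5,15,28); (15,19,1); (57,42,44); (8,33,55);
  (25,31,36); (19,8,29); (22,35,27); (31,34,58); (9,28,22); (11,61,51);
  (58,55,18); (26,57,8); (51,53,30); (3,36,62)], [:: (29,46); (36,11); (18,14);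
  (17,54); (14,39); (12,21); (60,17); (62,60); (63,57)], [:: (38,7); (20,54);
  (24,49); (40,20); (15,1); (42,30); (34,41); (41,44); (7,6)]);
 (16%nat, 10%nat, [:: (21,4,59); (20,12,23); (30,56,52); (10,45,9); (23,2,37);
  (37,18,63); (24,29,12); (5,15,28); (15,19,1); (57,42,44); (8,33,55);
  (17,13,7); (19,8,29); (2,44,39); (31,34,58); (4,25,13); (11,61,51);
  (58,55,18); (26,57,8); (51,53,30)], [:: (29,6); (36,34); (25,46); (22,17);
  (46,57); (14,20); (52,24); (55,19); (61,27); (63,38)], [:: (40,7); (54,20);
  (22,60); (33,58); (11,31); (15,1); (41,49); (62,5); (14,17); (36,35)]);
 (17%nat, 7%nat, [:: (11,4,42); (32,63,38); (25,7,52); (19,20,5); (54,16,45);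
  (40,32,12); (18,55,28); (20,26,2); (61,48,29); (3,65,8); (21,11,19);
  (67,12,24); (9,24,18); (6,28,41); (16,37,9); (24,44,46); (5,19,65);
  (33,43,27); (12,1,11); (45,3,7); (26,42,49); (30,29,3); (8,52,53);
  (27,15,48); (2,38,59)], [:: (37,25); (29,47); (22,35); (15,54); (13,66);
  (58,23); (64,4)], [:: (32,64); (39,2); (64,14); (33,47); (40,49); (63,58);
  (43,46)]);
 (17%nat, 8%nat, [:: (11,4,42); (32,63,38); (25,7,52); (19,20,5); (54,16,45);
  (40,32,12); (29,2,37); (20,26,2); (61,48,29); (3,65,8); (21,11,19);
  (67,12,24); (9,24,18); (64,44,54); (10,14,11); (44,22,40); (5,19,65);
  (33,43,27); (22,61,21); (45,3,7); (26,42,49); (30,29,3); (8,52,53);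
  (16,49,63)], [:: (31,20); (27,66); (18,28); (15,36); (13,59); (12,25);
  (62,32); (2,57)], [:: (47,15); (22,53); (64,37); (56,35); (43,56); (9,18);
  (23,28); (35,33)]);
 (17%nat, 9%nat, [:: (11,4,42); (32,63,38); (25,7,52); (19,20,5); (54,16,45);
  (40,32,12); (29,2,37); (20,26,2); (61,48,29); (3,65,8); (21,11,19);
  (67,12,24); (9,24,18); (64,44,54); (10,14,11); (44,22,40); (5,19,65);
  (33,43,27); (22,61,21); (45,3,7); (26,42,49); (30,29,3); (8,52,53)], [::
  (37,47); (41,56); (18,64); (16,63); (53,22); (55,43); (12,25); (62,33);
  (66,36)], [:: (57,21); (66,35); (28,55); (32,53); (35,49); (20,33); (9,18);
  (23,28); (59,57)]);
 (17%nat, 10%nat, [:: (11,4,42); (56,45,66); (25,7,52); (19,20,5); (27,2,35);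
  (40,32,12); (37,59,32); (20,26,2); (61,48,29); (3,65,8); (21,11,19);
  (67,12,24); (9,24,18); (64,44,54); (10,14,11); (44,22,40); (14,52,47);
  (33,43,27); (22,61,21); (45,3,7); (26,42,49); (30,29,3)], [:: (32,45);
  (29,44); (50,37); (16,63); (53,59); (55,25); (8,64); (62,31); (63,23);
  (2,20)], [:: (28,60); (9,46); (14,53); (41,16); (65,19); (53,39); (36,49);
  (30,21); (33,35); (56,57)]);
 (18%nat, 7%nat, [:: (20,5,27); (23,52,13); (31,43,44); (35,11,5); (6,25,37);
  (30,68,28); (21,1,45); (27,66,55); (71,16,3); (64,65,50); (2,22,14);
  (24,64,33); (15,40,21); (62,21,64); (14,57,61); (25,33,6); (26,61,41);
  (11,26,2); (32,55,4); (33,8,71); (3,29,59); (38,60,70); (19,51,49);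
  (17,10,56); (7,37,42); (16,27,62); (4,14,7)], [:: (29,16); (44,67); (50,69);
  (13,63); (12,60); (63,58); (67,66)], [:: (51,17); (9,34); (68,45); (24,41);
  (53,69); (34,20); (46,49)]);
 (18%nat, 8%nat, [:: (20,5,27); (23,52,13); (31,43,44); (35,11,5); (6,25,37);
  (10,19,60); (21,1,45); (27,66,55); (71,16,3); (64,65,50); (2,22,14);
  (44,41,64); (15,40,21); (29,45,31); (14,57,61); (25,33,6); (26,61,41);
  (11,26,2); (32,55,4); (33,8,71); (3,29,59); (38,60,70); (19,51,49);
  (17,10,56); (7,37,42); (16,27,62)], [:: (42,63); (48,40); (50,53); (59,68);
  (12,46); (9,58); (5,28); (68,67)], [:: (10,48); (38,70); (24,67); (34,59);
  (51,68); (33,17); (7,14); (66,69)]);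
 (18%nat, 9%nat, [:: (20,5,27); (23,52,13); (31,43,44); (35,11,5); (6,25,37);
  (16,67,33); (21,1,45); (27,66,55); (71,16,3); (64,65,50); (2,22,14);
  (44,41,64); (15,40,21); (29,45,31); (14,57,61); (25,33,6); (26,61,41);
  (11,26,2); (22,3,68); (33,8,71); (3,29,59); (38,60,70); (19,51,49);
  (17,10,56); (7,37,42)], [:: (32,66); (30,7); (48,40); (13,9); (12,62);
  (62,34); (63,46); (5,24); (68,10)], [:: (58,21); (63,23); (38,69); (28,71);
  (23,48); (60,9); (4,59); (11,27); (67,70)]);
 (18%nat, 10%nat, [:: (20,5,27); (23,20,53); (31,43,44); (35,11,5); (6,25,37);
  (12,2,9); (21,1,45); (27,66,55); (71,16,3); (64,65,50); (67,46,32);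
  (9,19,60); (15,40,21); (19,35,33); (14,57,61); (25,33,6); (26,61,41);
  (11,26,2); (32,55,4); (33,8,71); (3,29,59); (38,60,70); (2,48,14);
  (17,10,56)], [:: (30,28); (43,64); (44,24); (24,20); (22,31); (16,38);
  (59,49); (10,13); (65,42); (68,63)], [:: (29,64); (67,27); (30,59); (66,41);
  (11,34); (34,17); (7,23); (58,50); (40,45); (68,71)]);
 (19%nat, 7%nat, [:: (20,4,16); (53,49,7); (29,41,61); (40,23,62); (1,11,34);
  (60,12,58); (37,7,66); (6,70,41); (61,37,45); (65,52,50); (43,6,31);
  (5,3,47); (54,15,36); (24,51,44); (31,28,55); (17,9,22); (48,39,49);
  (26,40,5); (73,62,40); (4,27,3); (49,16,21); (55,73,13); (35,65,56);
  (25,2,42); (34,66,8); (30,45,48); (12,14,20); (2,56,70); (68,67,17)], [::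
  (44,4); (58,71); (14,1); (63,33); (10,69); (9,35); (69,24)], [:: (26,69);
  (9,54); (25,53); (29,44); (6,71); (51,47); (11,10)]);
 (19%nat, 8%nat, [:: (52,6,35); (10,28,55); (29,41,61); (12,51,8); (1,11,34);
  (44,47,58); (45,69,23); (13,44,43); (61,37,45); (65,52,50); (33,73,56);
  (5,3,47); (37,63,59); (7,36,46); (22,13,4); (30,67,22); (35,7,62); (26,40,5);
  (21,49,7); (2,46,20); (23,64,13); (60,53,75); (34,9,33); (25,2,42);
  (20,26,54); (17,12,27); (4,5,2); (14,31,70)], [:: (40,60); (48,72); (27,21);
  (58,66); (9,25); (8,73); (70,65); (73,32)], [:: (68,50); (9,25); (15,29);
  (64,1); (36,48); (11,4); (49,43); (16,21)]);
 (19%nat, 9%nat, [:: (12,4,11); (53,49,7); (29,41,61); (9,44,30); (1,11,34);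
  (35,56,62); (45,69,23); (6,70,41); (61,37,45); (32,31,55); (43,6,31);
  (5,3,47); (37,63,59); (7,36,46); (22,13,4); (30,67,22); (63,66,48);
  (26,40,5); (73,62,40); (2,46,20); (20,48,15); (55,73,13); (36,26,25);
  (25,2,42); (28,15,36); (17,12,27); (4,5,2)], [:: (34,8); (27,51); (24,49);
  (58,33); (16,32); (14,43); (11,58); (10,17); (68,6)], [:: (16,53); (56,28);
  (69,20); (60,1); (9,72); (73,9); (70,59); (50,45); (54,52)]);
 (19%nat, 10%nat, [:: (12,4,11); (53,49,7); (29,41,61); (9,44,30); (1,11,34);
  (28,31,36); (45,69,23); (6,70,41); (61,37,45); (65,52,50); (43,6,31);
  (5,3,47); (37,63,59); (7,36,46); (22,13,4); (30,67,22); (35,7,62); (26,40,5);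
  (73,62,40); (2,46,20); (20,48,15); (55,73,13); (36,26,25); (25,2,42);
  (34,66,8); (17,12,27)], [:: (32,55); (27,43); (52,1); (18,33); (60,69);
  (62,58); (63,16); (66,49); (8,6); (72,73)], [:: (17,56); (56,28); (54,5);
  (75,51); (70,53); (60,47); (2,14); (9,20); (51,45); (21,24)]);
 (20%nat, 7%nat, [:: (36,77,10); (37,10,6); (10,65,18); (6,72,79); (78,24,23);
  (25,71,13); (27,66,54); (9,58,64); (38,59,8); (33,57,29); (16,28,69);
  (69,14,11); (4,32,2); (24,1,71); (63,70,9); (1,4,22); (62,19,34); (28,44,67);
  (21,18,63); (72,11,38); (75,79,30); (7,69,52); (35,6,17); (19,12,50);
  (65,43,68); (48,15,1); (50,29,45); (51,13,56); (39,7,33); (14,41,75);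
  (31,16,14)], [:: (34,72); (26,35); (23,74); (58,15); (13,36); (68,70);
  (77,31)], [:: (61,17); (78,30); (32,56); (5,64); (76,67); (44,36); (43,48)]);
 (20%nat, 8%nat, [:: (24,3,77); (36,79,4); (37,8,41); (31,38,57); (30,5,53);
  (25,59,69); (70,7,33); (77,2,48); (12,66,37); (33,57,29); (54,35,10);
  (6,72,16); (4,32,2); (38,70,13); (27,58,36); (2,46,19); (41,52,63);
  (79,71,67); (13,69,62); (66,74,25); (58,73,76); (8,11,70); (5,27,39);
  (19,12,50); (15,61,45); (48,15,1); (21,63,27); (45,14,6); (17,47,38);
  (28,16,78)], [:: (46,74); (51,35); (57,14); (62,75); (64,65); (69,18);
  (71,58); (7,52)], [:: (26,65); (79,42); (9,54); (12,75); (71,56); (64,77);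
  (21,19); (23,24)]);
 (20%nat, 9%nat, [:: (24,3,77); (36,79,4); (37,8,41); (31,38,57); (30,5,53);
  (25,59,69); (28,37,78); (77,2,48); (12,66,37); (33,57,29); (9,67,52);
  (6,72,16); (4,32,2); (38,70,13); (27,58,36); (2,46,19); (41,52,63);
  (79,71,67); (13,69,62); (66,74,25); (58,73,76); (8,11,70); (5,27,39);
  (19,12,50); (15,61,45); (48,15,1); (23,35,79); (45,14,6); (17,47,38)], [::
  (46,65); (29,14); (26,21); (21,75); (18,42); (64,26); (69,18); (70,35);
  (73,74)], [:: (27,64); (71,36); (33,7); (68,13); (10,28); (23,6); (64,77);
  (61,63); (17,16)]);
 (20%nat, 10%nat, [:: (24,3,77); (36,79,4); (37,8,41); (31,38,57); (30,5,53);
  (25,59,69); (28,37,78); (77,2,48); (12,66,37); (33,57,29); (9,67,52);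
  (6,72,16); (4,32,2); (38,70,13); (27,58,36); (2,46,19); (41,52,63);
  (79,71,67); (13,69,62); (66,74,25); (58,73,76); (8,11,70); (5,27,39);
  (19,12,50); (15,61,45); (48,15,1); (23,35,79); (45,14,6)], [:: (46,65);
  (29,26); (26,21); (21,42); (62,18); (17,33); (64,38); (69,75); (10,17);
  (73,35)], [:: (27,64); (64,29); (71,45); (68,13); (10,28); (30,47); (14,1);
  (74,65); (61,63); (23,24)]);
 (21%nat, 7%nat, [:: (34,3,68); (6,8,55); (1,66,79); (40,10,51); (26,61,41);
  (16,76,46); (47,40,22); (46,28,43); (27,54,31); (53,41,80); (18,67,76);
  (79,33,9); (30,56,3); (73,48,82); (41,77,4); (64,83,81); (15,79,17);
  (8,52,58); (39,46,71); (2,80,75); (28,39,29); (59,65,10); (23,62,14);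
  (14,13,20); (17,29,33); (22,5,8); (9,37,69); (35,24,23); (10,23,61);
  (4,44,30); (12,64,48); (33,19,45); (7,69,25)], [:: (36,56); (52,50); (55,24);
  (60,47); (19,74); (71,32); (3,34)], [:: (57,22); (5,38); (18,74); (16,43);
  (1,68); (37,25); (15,7)]);
 (21%nat, 8%nat, [:: (34,3,68); (6,8,55); (24,48,18); (40,10,51); (26,61,41);
  (3,76,83); (47,40,22); (46,28,43); (27,54,31); (53,41,80); (18,67,76);
  (2,22,57); (70,57,30); (36,31,82); (41,77,4); (64,83,81); (15,79,17);
  (8,52,58); (77,82,65); (39,73,59); (28,39,29); (59,65,10); (23,62,14);
  (11,43,56); (17,29,33); (22,5,8); (9,37,69); (54,32,60); (10,23,61);
  (4,13,37); (12,64,48); (33,19,45)], [:: (35,7); (32,46); (29,47); (19,26);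
  (16,3); (71,40); (5,74); (83,23)], [:: (78,38); (16,66); (15,68); (50,25);
  (38,26); (1,9); (25,30); (75,74)]);
 (21%nat, 9%nat, [:: (34,3,68); (45,81,9); (7,14,31); (40,10,51); (26,61,41);
  (27,56,40); (47,40,22); (38,51,45); (3,47,73); (32,6,37); (18,67,76);
  (68,36,39); (4,20,12); (23,78,5); (59,65,10); (64,83,81); (15,79,17);
  (10,12,59); (71,52,3); (2,80,75); (35,23,57); (51,28,24); (5,25,82);
  (11,43,56); (8,9,34); (12,82,83); (9,37,69); (30,53,60); (36,44,14);
  (29,76,62); (41,31,79)], [:: (31,15); (28,67); (24,43); (62,66); (65,27);
  (17,71); (70,50); (6,38); (83,26)], [:: (25,69); (30,75); (4,50); (80,29);
  (46,74); (48,72); (18,41); (33,18); (11,1)]);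
 (21%nat, 10%nat, [:: (34,3,68); (6,8,55); (1,38,7); (13,26,10); (26,61,41);
  (24,74,46); (40,66,52); (16,40,57); (27,54,31); (39,25,66); (18,67,76);
  (4,24,59); (70,57,30); (36,31,82); (41,77,4); (64,83,81); (15,79,17);
  (8,52,58); (32,33,45); (2,80,75); (28,39,29); (10,35,74); (23,62,14);
  (11,43,56); (17,29,33); (22,5,8); (9,37,69); (30,53,60); (33,10,18);
  (29,76,16)], [:: (38,22); (37,65); (35,54); (31,3); (25,73); (65,72); (12,6);
  (7,43); (79,15); (81,48)], [:: (51,11); (34,72); (9,59); (62,32); (38,9);
  (40,14); (77,18); (5,23); (80,65); (83,82)]);
 (22%nat, 7%nat, [:: (24,27,69); (6,30,56); (86,33,46); (3,57,72); (71,20,78);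
  (79,78,17); (18,82,85); (45,6,40); (12,72,9); (5,37,82); (4,65,84);
  (16,14,2); (31,84,43); (28,73,80); (1,5,57); (41,21,59); (52,86,18);
  (38,53,47); (48,58,63); (58,59,51); (67,87,13); (8,41,25); (75,25,58);
  (14,55,76); (42,63,65); (7,13,23); (39,32,67); (78,2,79); (77,39,8);
  (20,3,62); (32,51,14); (29,40,39); (25,61,29); (33,75,5); (19,46,55)], [::
  (37,48); (35,73); (54,30); (61,52); (26,75); (23,31); (15,83)], [:: (77,29);
  (74,35); (16,76); (7,31); (70,47); (26,43); (28,24)]);
 (22%nat, 8%nat, [:: (39,3,57); (35,40,56); (15,38,83); (3,78,58); (64,13,68);
  (13,33,41); (37,71,48); (78,79,77); (9,74,28); (1,50,85); (20,14,18);
  (60,59,35); (6,32,64); (17,34,19); (30,12,53); (31,37,24); (59,10,38);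
  (74,72,46); (41,15,72); (40,69,8); (55,80,21); (4,46,55); (65,27,30);
  (42,49,11); (12,45,9); (11,62,76); (21,75,69); (72,29,10); (34,6,16);
  (27,42,47); (7,43,32); (5,83,13); (80,76,27); (38,9,2)], [:: (45,4); (36,43);
  (56,73); (62,63); (25,14); (69,74); (18,3); (86,80)], [:: (79,39); (67,16);
  (71,41); (61,36); (40,61); (81,64); (12,24); (31,30)]);
 (22%nat, 9%nat, [:: (70,34,73); (30,64,63); (15,38,83); (3,78,58); (64,13,68);
  (37,41,20); (45,24,61); (38,69,84); (12,21,19); (40,8,26); (20,14,18);
  (60,59,35); (31,84,43); (14,60,2); (7,47,24); (4,40,65); (59,10,38);
  (35,43,70); (41,15,72); (83,81,6); (26,83,45); (13,25,14); (65,27,30);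
  (52,49,41); (32,37,77); (11,62,76); (21,75,69); (19,9,21); (34,6,16);
  (27,42,47); (10,58,49); (42,28,11); (2,73,1)], [:: (39,7); (55,81); (63,27);
  (71,13); (16,10); (79,42); (8,80); (6,29); (1,55)], [:: (33,79); (28,80);
  (32,85); (59,5); (64,32); (79,50); (3,29); (17,36); (25,18)]);
 (22%nat, 10%nat, [:: (39,3,57); (30,64,63); (15,38,83); (3,78,58); (64,13,68);
  (32,87,20); (63,39,79); (80,83,81); (38,23,59); (40,8,26); (20,14,18);
  (60,59,35); (31,84,43); (17,34,19); (7,47,24); (4,40,65); (59,10,38);
  (35,43,70); (41,15,72); (83,81,6); (55,80,21); (45,37,7); (65,27,30);
  (52,49,41); (9,41,67); (11,62,76); (21,75,69); (72,29,10); (34,6,16);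
  (27,42,47); (70,24,12); (42,28,11)], [:: (51,9); (26,31); (19,4); (14,46);
  (75,84); (76,48); (78,61); (82,1); (86,49); (87,71)], [:: (27,69); (33,82);
  (14,52); (5,56); (78,25); (77,45); (13,85); (2,79); (28,19); (29,36)]);
 (23%nat, 7%nat, [:: (31,64,72); (60,55,61); (19,33,50); (9,21,5); (44,71,47);
  (2,45,13); (34,12,25); (21,29,82); (20,49,45); (52,9,37); (42,80,81);
  (85,35,6); (28,82,35); (11,59,28); (33,43,1); (63,34,56); (24,81,62);
  (17,10,15); (37,16,67); (86,54,88); (16,74,3); (66,40,80); (5,37,73);
  (67,89,86); (35,18,77); (22,53,79); (89,65,53); (4,28,19); (84,26,44);
  (82,84,41); (15,6,91); (14,78,76); (41,67,40); (12,32,7); (62,22,36);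
  (18,27,65); (45,4,39)], [:: (49,30); (39,89); (54,74); (36,16); (65,17);
  (79,11); (91,4)], [:: (84,36); (21,58); (18,48); (55,75); (78,63); (59,70);
  (90,8)]);
 (23%nat, 8%nat, [:: (57,5,89); (61,12,33); (6,72,50); (22,73,76); (1,11,56);
  (8,16,35); (38,28,67); (4,83,25); (43,9,53); (2,8,80); (45,67,27);
  (76,62,71); (68,81,44); (12,7,38); (67,88,70); (37,48,73); (58,41,31);
  (87,86,74); (51,22,64); (13,20,3); (71,76,49); (48,50,83); (29,63,14);
  (33,80,52); (20,59,45); (3,15,17); (19,4,36); (82,52,37); (14,42,16);
  (26,18,24); (30,6,60); (15,33,90); (9,66,65); (40,34,41); (39,43,32);
  (42,57,1)], [:: (56,9); (60,59); (28,81); (27,85); (74,20); (75,54); (81,29);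
  (85,42)], [:: (72,31); (30,60); (26,89); (61,37); (55,39); (48,61); (19,24);
  (88,84)]);
 (23%nat, 9%nat, [:: (36,84,2); (61,12,33); (6,72,50); (57,40,32); (1,11,56);
  (13,16,40); (38,28,67); (4,83,25); (43,9,53); (2,8,80); (50,34,15);
  (76,62,71); (68,81,44); (12,7,38); (67,88,70); (37,48,73); (28,82,7);
  (26,18,31); (51,22,64); (18,53,59); (71,76,49); (84,1,30); (29,63,14);
  (33,80,52); (20,59,45); (3,15,17); (19,4,36); (82,52,37); (14,42,16);
  (40,39,72); (30,6,60); (15,33,90); (9,66,65); (27,20,24); (5,60,4)], [::
  (47,20); (48,1); (39,8); (58,89); (60,41); (70,29); (75,26); (11,61);
  (7,86)], [:: (88,37); (22,74); (19,49); (51,35); (42,54); (74,85); (83,90);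
  (81,86); (27,24)]);
 (23%nat, 10%nat, [:: (36,84,2); (61,12,33); (6,72,50); (22,73,76); (1,11,56);
  (5,45,29); (38,28,67); (13,51,20); (43,9,53); (2,8,80); (45,67,27);
  (76,62,71); (68,81,44); (17,21,8); (67,88,70); (37,48,73); (28,82,7);
  (81,50,86); (51,22,64); (18,53,59); (39,26,88); (84,1,30); (32,15,17);
  (33,80,52); (20,59,45); (4,16,74); (19,4,36); (82,52,37); (14,42,16);
  (40,39,72); (30,6,60); (15,33,90); (9,66,65); (27,20,24)], [:: (44,31);
  (50,49); (57,41); (58,3); (29,89); (26,87); (21,84); (12,55); (7,1);
  (89,32)], [:: (83,40); (14,65); (25,90); (81,57); (15,34); (5,85); (42,31);
  (26,18); (34,27); (19,14)]);
 (24%nat, 7%nat, [:: (81,80,83); (55,85,91); (45,57,16); (77,75,65); (6,49,20);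
  (32,10,36); (44,45,76); (38,59,39); (21,78,29); (7,3,47); (30,22,26);
  (37,62,63); (3,41,86); (2,6,93); (54,42,75); (34,39,85); (39,33,11);
  (53,15,22); (33,89,68); (50,56,81); (28,30,62); (26,60,45); (67,37,50);
  (36,7,41); (4,73,78); (82,63,33); (25,9,37); (18,46,73); (87,52,44);
  (65,23,40); (13,16,51); (61,29,89); (5,18,32); (8,90,52); (10,69,71);
  (27,76,19); (80,94,9); (20,43,31); (23,50,8)], [:: (47,15); (56,42); (74,87);
  (17,7); (84,46); (85,55); (95,53)], [:: (17,70); (60,20); (18,77); (70,93);
  (10,87); (35,17); (79,95)]);
 (24%nat, 8%nat, [:: (65,26,76); (33,71,83); (1,19,55); (8,40,12); (10,55,54);
  (5,85,64); (82,76,84); (29,56,93); (41,67,51); (15,22,66); (6,7,86);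
  (42,82,41); (75,1,4); (34,57,92); (11,81,5); (30,13,47); (94,27,36);
  (51,8,33); (27,66,17); (49,9,78); (80,14,52); (9,77,37); (13,73,58);
  (7,69,91); (43,92,10); (76,87,69); (39,52,59); (64,18,61); (18,62,67);
  (17,15,82); (19,61,35); (12,32,95); (3,74,63); (74,12,8); (36,5,28);
  (92,21,87); (44,75,77); (46,23,88)], [:: (40,14); (38,75); (59,6); (35,81);
  (68,3); (70,9); (71,74); (73,16)], [:: (43,94); (89,47); (2,41); (21,53);
  (15,34); (19,6); (46,36); (85,79)]);
 (24%nat, 9%nat, [:: (39,79,32); (33,71,2); (34,4,1); (52,11,13); (40,43,14);
  (37,35,7); (82,76,84); (29,93,61); (41,67,51); (23,80,41); (18,33,39);
  (21,39,22); (92,23,88); (27,58,6); (11,81,5); (6,17,92); (94,27,36);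
  (51,8,33); (15,94,59); (25,29,47); (80,14,52); (9,77,37); (13,73,58);
  (7,69,91); (43,85,80); (26,7,17); (1,47,10); (28,82,83); (79,59,25);
  (10,3,16); (35,54,87); (65,51,9); (42,41,67); (74,12,8); (36,5,28);
  (30,74,86); (49,34,85)], [:: (50,45); (58,23); (32,78); (20,73); (19,35);
  (84,71); (8,21); (5,69); (3,63)], [:: (49,95); (93,50); (74,19); (75,15);
  (50,20); (43,62); (12,26); (20,31); (56,49)]);
 (24%nat, 10%nat, [:: (39,79,32); (33,71,2); (8,53,12); (52,11,13); (40,43,14);
  (37,35,7); (82,76,84); (29,93,61); (41,67,51); (38,37,56); (5,83,20);
  (21,39,22); (34,80,23); (27,58,6); (11,81,5); (6,17,92); (94,27,36);
  (51,8,33); (15,94,59); (25,29,75); (80,14,52); (9,77,37); (13,73,58);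
  (7,69,91); (43,92,10); (26,7,17); (32,47,41); (28,82,83); (18,62,67);
  (10,3,16); (19,46,39); (65,51,9); (3,74,63); (74,12,8); (36,5,28);
  (92,21,87)], [:: (47,80); (50,66); (54,73); (61,1); (66,88); (73,86);
  (20,43); (17,81); (84,47); (1,42)], [:: (50,95); (69,26); (93,34); (85,25);
  (76,42); (21,52); (35,61); (74,56); (19,31); (57,54)]);
 (25%nat, 7%nat, [:: (15,44,33); (1,65,35); (35,67,93); (83,9,62); (45,66,38);
  (96,42,7); (10,81,2); (22,77,74); (79,47,95); (59,8,65); (33,32,59);
  (88,55,23); (27,90,13); (38,39,43); (40,68,73); (36,89,56); (29,15,66);
  (39,63,9); (13,94,70); (7,48,34); (34,13,57); (8,98,92); (3,30,10);
  (18,36,91); (44,60,47); (23,28,69); (84,29,60); (37,41,58); (69,51,12);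
  (47,64,6); (9,87,97); (80,74,76); (32,54,36); (49,97,98); (26,78,40);
  (42,22,44); (30,19,83); (2,10,19); (19,80,14); (6,45,30); (86,71,42)], [::
  (52,37); (46,15); (57,88); (72,84); (24,96); (89,72); (5,87)], [:: (51,91);
  (3,40); (20,1); (77,61); (11,99); (54,62); (31,38)]);
 (25%nat, 8%nat, [:: (22,7,15); (47,42,94); (28,71,98); (71,57,8); (68,99,29);
  (58,90,53); (33,39,57); (23,68,71); (40,80,38); (38,92,58); (37,40,59);
  (44,34,11); (41,89,82); (12,53,88); (48,21,92); (96,64,42); (1,77,67);
  (55,19,60); (5,84,78); (90,62,5); (35,58,20); (89,78,93); (18,17,19);
  (81,27,13); (34,8,28); (7,3,16); (24,33,69); (79,63,7); (16,26,22);
  (36,38,33); (61,23,47); (92,36,83); (20,69,80); (27,82,81); (6,18,35);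
  (46,43,27); (49,88,21); (2,79,51); (26,52,61); (43,30,56)], [:: (31,18);
  (30,4); (83,14); (85,36); (14,30); (87,1); (9,65); (97,52)], [:: (37,83);
  (66,11); (70,10); (63,2); (91,59); (34,65); (17,96); (24,12)]);
 (25%nat, 9%nat, [:: (48,74,95); (35,46,24); (12,16,19); (11,51,8); (76,63,29);
  (38,43,37); (39,18,91); (9,54,92); (29,28,93); (16,26,22); (37,40,59);
  (46,11,85); (19,68,12); (21,84,1); (5,86,32); (74,20,78); (80,42,58);
  (72,49,17); (42,15,54); (98,92,6); (47,60,48); (41,31,51); (44,96,67);
  (31,58,68); (83,65,56); (7,3,16); (4,57,98); (3,17,69); (87,48,66);
  (27,61,97); (10,82,31); (92,36,83); (33,19,20); (1,90,60); (22,2,57);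
  (60,67,36); (49,88,21); (15,24,47); (57,33,38)], [:: (45,30); (64,35);
  (34,64); (32,70); (70,84); (77,33); (18,23); (86,15); (94,71)], [:: (2,62);
  (18,55); (41,69); (74,98); (28,13); (55,44); (42,34); (88,95); (43,41)]);
 (25%nat, 10%nat, [:: (11,34,55); (35,46,24); (43,61,76); (10,29,95);
  (73,55,43); (42,73,37); (39,18,91); (9,54,92); (29,69,72); (16,26,22);
  (37,40,59); (17,81,88); (19,68,12); (21,84,1); (5,86,32); (74,20,78);
  (80,42,58); (72,49,17); (45,30,56); (98,92,6); (77,12,84); (38,28,48);
  (44,96,67); (31,58,68); (30,60,71); (7,3,16); (4,57,98); (34,63,87);
  (87,48,66); (36,38,33); (47,21,13); (92,36,83); (33,19,20); (1,90,60);
  (22,2,57); (60,67,36); (49,88,21); (15,24,47)], [:: (52,51); (54,93); (41,5);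
  (68,42); (24,38); (18,65); (14,70); (12,28); (94,99); (3,34)], [:: (26,77);
  (69,17); (8,65); (41,1); (54,15); (14,51); (97,62); (73,82); (4,98);
  (15,13)]);
 (26%nat, 7%nat, [:: (47,15,60); (37,32,81); (29,97,65); (11,39,100);
  (2,90,11); (55,37,47); (33,83,80); (72,8,75); (28,74,35); (20,59,101);
  (48,80,49); (22,91,92); (6,50,16); (100,41,98); (5,82,84); (44,11,67);
  (18,103,91); (77,84,2); (36,99,9); (46,66,102); (1,55,59); (12,86,42);
  (39,61,53); (17,20,29); (23,46,57); (25,18,87); (38,93,5); (30,51,24);
  (69,6,90); (64,65,27); (15,94,31); (13,95,89); (14,33,38); (7,40,12);
  (41,31,95); (80,19,4); (83,101,48); (42,48,30); (88,87,37); (50,4,34);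
  (43,60,14); (45,2,83); (53,42,13)], [:: (70,51); (31,66); (19,64); (94,62);
  (95,8); (8,76); (3,25)], [:: (96,25); (73,49); (36,57); (15,100); (10,27);
  (56,43); (70,63)]);
 (26%nat, 8%nat, [:: (9,71,94); (16,38,83); (33,77,69); (84,8,93); (14,84,80);
  (60,2,29); (29,59,53); (43,51,85); (81,43,40); (28,39,27); (94,86,45);
  (32,83,3); (31,49,81); (13,100,75); (19,16,91); (41,102,13); (3,27,17);
  (21,37,95); (92,70,20); (38,101,99); (2,4,37); (25,80,36); (11,44,1);
  (15,25,34); (49,18,102); (5,93,6); (27,48,12); (35,91,38); (34,33,64);
  (1,40,47); (48,28,58); (64,20,25); (51,56,98); (59,5,54); (50,98,42);
  (47,22,59); (8,57,68); (17,58,23); (58,21,35); (36,79,14); (6,92,74);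
  (39,54,32)], [:: (42,76); (67,4); (74,65); (80,97); (82,9); (86,72); (7,71);
  (4,19)], [:: (92,45); (77,13); (31,69); (57,29); (90,7); (7,23); (100,87);
  (89,88)]);
 (26%nat, 9%nat, [:: (35,3,14); (37,21,45); (102,100,21); (91,44,9); (57,40,2);
  (19,73,12); (36,76,74); (8,50,90); (23,84,66); (29,99,94); (42,6,34);
  (49,67,30); (41,72,59); (33,69,63); (20,2,47); (5,29,22); (17,42,1);
  (24,103,83); (31,48,51); (72,33,32); (10,87,96); (25,32,49); (7,10,60);
  (18,46,76); (50,13,81); (98,63,92); (89,95,103); (46,57,71); (27,75,43);
  (3,36,93); (43,28,62); (48,39,85); (51,56,98); (30,94,39); (1,102,46);
  (12,68,91); (34,12,100); (59,5,15); (4,101,19); (28,55,16); (16,51,20)], [::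
  (60,37); (40,75); (65,38); (66,53); (22,29); (83,13); (14,55); (11,73);
  (95,80)], [:: (8,61); (10,70); (41,74); (44,71); (84,1); (99,80); (4,93);
  (23,11); (58,54)]);
 (26%nat, 10%nat, [:: (9,71,94); (8,100,7); (33,77,69); (84,8,93); (50,92,70);
  (60,2,29); (29,59,53); (43,51,85); (81,43,40); (38,13,31); (74,27,72);
  (32,64,71); (31,49,81); (86,55,65); (19,16,91); (63,90,75); (48,34,58);
  (21,37,95); (92,70,20); (47,17,4); (2,4,37); (25,80,36); (1,88,63);
  (15,25,34); (88,60,59); (5,93,6); (27,48,12); (35,91,38); (34,33,64);
  (11,44,1); (37,46,51); (101,65,25); (22,18,60); (59,5,54); (42,87,39);
  (39,54,84); (7,68,47); (17,58,23); (58,21,35); (36,79,14)], [:: (51,13);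
  (55,102); (40,3); (28,22); (80,5); (14,83); (13,99); (10,17); (98,89);
  (100,11)], [:: (98,41); (86,23); (97,31); (19,56); (48,76); (77,57); (80,96);
  (96,84); (49,53); (24,22)]);
 (27%nat, 7%nat, [:: (4,96,28); (24,42,33); (43,77,45); (8,43,105); (22,36,51);
  (46,1,80); (102,19,44); (49,64,21); (5,73,61); (44,66,43); (48,6,88);
  (50,55,10); (93,78,96); (42,83,36); (12,52,16); (21,106,58); (9,100,83);
  (35,47,55); (53,61,102); (17,48,107); (95,84,79); (16,18,46); (79,103,65);
  (33,26,103); (106,85,11); (32,41,57); (45,71,84); (94,57,1); (97,31,75);
  (1,75,94); (77,17,56); (3,63,98); (30,89,99); (38,67,100); (72,28,86);
  (34,21,72); (37,104,17); (28,105,50); (10,79,82); (89,59,39); (40,46,52);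
  (25,98,32); (7,45,23); (41,60,49); (39,101,7)], [:: (56,13); (57,89);
  (47,70); (26,37); (23,76); (20,30); (18,53)], [:: (104,33); (4,82); (20,44);
  (106,99); (47,51); (3,5); (90,91)]);
 (27%nat, 8%nat, [:: (18,77,68); (8,107,15); (35,86,1); (65,60,96); (34,14,93);
  (22,67,101); (38,96,94); (5,30,80); (39,49,32); (53,16,63); (15,61,87);
  (29,85,33); (20,73,22); (23,5,47); (71,40,8); (26,9,106); (50,37,31);
  (28,52,34); (96,64,36); (33,98,9); (51,57,52); (36,71,75); (44,15,28);
  (4,66,67); (6,88,48); (32,104,83); (47,97,30); (45,29,100); (84,36,14);
  (30,8,41); (21,18,38); (83,12,57); (14,99,55); (42,47,39); (77,76,64);
  (2,25,102); (1,13,20); (59,62,16); (3,69,26); (17,46,11); (99,103,19);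
  (52,70,73); (48,44,74); (40,53,43)], [:: (46,44); (41,61); (89,49); (16,2);
  (95,21); (11,89); (10,42); (7,40)], [:: (98,43); (84,35); (70,22); (97,58);
  (17,87); (7,90); (78,93); (69,83)]);
 (27%nat, 9%nat, [:: (23,12,85); (48,38,63); (20,28,14); (65,60,96);
  (15,40,62); (59,19,94); (90,29,61); (97,41,90); (74,48,99); (21,107,37);
  (29,1,104); (4,49,15); (44,85,6); (25,94,101); (9,69,22); (45,80,91);
  (50,34,105); (28,52,34); (47,18,39); (68,72,76); (39,87,100); (13,78,18);
  (96,26,78); (73,106,29); (26,82,17); (76,95,83); (8,83,53); (22,77,58);
  (51,30,32); (31,73,64); (33,2,84); (52,14,102); (41,71,31); (78,10,74);
  (16,44,20); (62,63,21); (98,97,12); (14,21,88); (70,57,67); (6,32,49);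
  (53,103,106); (36,17,16); (7,66,72)], [:: (42,66); (37,13); (24,44); (89,23);
  (17,2); (103,51); (105,36); (2,93); (1,10)], [:: (3,58); (73,23); (46,92);
  (5,68); (57,96); (9,37); (43,59); (71,86); (11,3)]);
 (27%nat, 10%nat, [:: (17,68,10); (48,38,63); (20,42,14); (65,60,96);
  (24,86,52); (59,19,94); (90,29,61); (1,12,57); (74,48,99); (21,107,37);
  (29,1,104); (102,39,31); (44,85,6); (25,94,101); (103,41,44); (26,9,106);
  (50,34,105); (28,52,34); (47,18,39); (68,72,76); (39,87,100); (13,78,18);
  (96,26,78); (73,106,29); (19,24,2); (76,95,83); (8,83,53); (22,77,58);
  (3,69,26); (31,73,64); (33,2,84); (52,14,102); (53,103,56); (78,10,74);
  (16,44,20); (62,63,21); (98,97,12); (14,21,88); (70,57,67); (97,82,9);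
  (2,99,60); (36,17,16)], [:: (57,8); (45,3); (66,23); (41,71); (71,25);
  (85,73); (93,32); (9,49); (101,36); (4,15)], [:: (43,98); (35,84); (59,13);
  (13,53); (72,89); (30,46); (17,32); (85,71); (87,93); (90,92)]);
 (28%nat, 7%nat, [:: (27,65,60); (41,47,86); (14,75,49); (32,13,82);
  (78,109,65); (46,3,78); (8,19,48); (43,10,29); (63,36,27); (95,89,110);
  (38,81,63); (19,16,58); (90,83,94); (37,72,26); (94,48,44); (50,71,51);
  (48,8,30); (21,66,101); (103,24,8); (6,102,99); (99,29,87); (4,58,108);
  (89,9,64); (100,79,34); (33,2,90); (16,91,57); (40,42,67); (29,103,88);
  (20,67,18); (10,63,40); (77,86,55); (97,26,77); (110,12,20); (25,95,59);
  (81,21,7); (52,20,22); (45,37,97); (36,31,1); (11,14,4); (51,61,62);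
  (111,97,50); (5,73,111); (44,5,17); (42,54,37); (7,23,76); (59,18,103);
  (24,60,92)], [:: (57,19); (58,24); (47,102); (39,15); (30,100); (26,25);
  (109,46)], [:: (5,53); (23,64); (83,43); (39,6); (95,108); (89,96); (13,7)]);
 (28%nat, 8%nat, [:: (14,106,49); (49,92,44); (37,64,69); (20,70,95);
  (89,43,10); (13,27,24); (86,74,105); (39,26,16); (60,61,62); (65,4,15);
  (27,3,26); (11,17,109); (2,40,70); (4,44,83); (54,63,85); (16,49,73);
  (46,59,93); (79,25,77); (44,86,25); (31,42,107); (24,9,54); (19,83,8);
  (90,24,96); (36,66,23); (78,95,86); (51,45,47); (55,53,103); (10,100,3);
  (103,58,37); (32,34,87); (97,60,22); (3,82,94); (8,109,29); (62,94,52);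
  (107,15,108); (69,88,53); (42,103,111); (83,73,7); (1,13,39); (35,71,89);
  (30,85,71); (40,97,91); (48,16,60); (38,7,48); (87,20,4); (18,77,41)], [::
  (53,21); (67,5); (71,76); (91,31); (17,104); (12,34); (105,74); (106,98)],
  [:: (72,14); (18,67); (68,39); (63,90); (35,18); (78,65); (65,72); (82,78)]);
 (28%nat, 9%nat, [:: (19,81,69); (41,47,86); (14,75,49); (53,12,26);
  (24,70,64); (105,102,32); (55,53,58); (1,98,10); (63,36,27); (2,1,8);
  (11,101,100); (26,21,59); (22,4,79); (97,74,104); (38,71,63); (9,29,87);
  (48,8,30); (21,66,101); (44,49,81); (46,69,29); (107,87,103); (4,58,108);
  (34,99,31); (100,79,34); (54,93,73); (16,91,57); (40,42,67); (29,103,88);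
  (20,67,18); (10,63,40); (8,2,96); (89,92,41); (13,32,78); (52,23,66);
  (43,44,77); (51,55,82); (32,82,17); (106,10,14); (25,105,24); (17,68,11);
  (47,62,60); (3,38,25); (31,17,36); (42,54,37); (33,77,48)], [:: (62,105);
  (67,93); (73,13); (37,55); (36,52); (35,95); (82,21); (27,99); (94,68)], [::
  (43,96); (76,24); (42,90); (102,61); (7,83); (9,100); (22,11); (38,48);
  (70,73)]);
 (28%nat, 10%nat, [:: (27,65,60); (23,93,66); (14,75,49); (61,60,22);
  (24,70,64); (46,3,78); (57,96,13); (33,49,81); (63,36,27); (95,89,110);
  (38,81,63); (19,16,58); (90,83,94); (37,72,26); (6,82,25); (50,71,51);
  (48,8,30); (21,66,101); (103,24,8); (73,44,80); (99,29,87); (4,58,108);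
  (34,99,31); (100,79,34); (47,95,23); (16,91,57); (107,69,82); (59,64,79);
  (20,67,18); (10,63,40); (77,86,55); (3,47,95); (110,12,20); (26,55,36);
  (81,21,7); (25,57,24); (45,37,97); (43,31,102); (11,14,4); (8,18,19);
  (111,97,50); (36,27,86); (44,5,17); (42,54,37)], [:: (54,88); (52,1);
  (41,67); (72,2); (32,77); (82,68); (83,92); (94,90); (15,89); (105,71)], [::
  (41,102); (96,53); (62,23); (107,77); (93,6); (15,103); (99,106); (6,2);
  (59,62); (11,13)]);
 (29%nat, 7%nat, [:: (39,80,86); (35,19,14); (34,26,54); (60,88,27); (9,8,60);
  (53,27,30); (115,39,83); (96,12,112); (40,92,93); (42,106,102); (98,104,71);
  (30,40,75); (17,111,16); (95,61,22); (97,34,72); (43,52,2); (48,82,59);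
  (71,65,33); (103,22,24); (15,66,111); (38,49,23); (49,3,73); (8,107,67);
  (110,74,15); (16,41,101); (114,112,103); (22,67,98); (3,69,7); (52,94,77);
  (92,2,12); (5,109,36); (55,110,85); (25,114,96); (32,81,18); (79,1,31);
  (27,73,8); (50,54,65); (47,103,61); (11,32,39); (28,7,74); (85,86,17);
  (57,50,63); (12,55,91); (46,108,81); (72,77,69); (26,63,44); (7,10,106);
  (14,98,76); (41,38,50)], [:: (62,79); (65,107); (36,20); (83,57); (93,47);
  (106,13); (112,68)], [:: (105,57); (97,56); (92,13); (78,44); (88,64);
  (48,33); (19,5)]);
 (29%nat, 8%nat, [:: (21,5,23); (51,37,16); (9,74,73); (46,51,27); (22,17,50);
  (32,63,71); (112,57,45); (53,86,42); (13,1,54); (77,98,41); (98,91,60);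
  (8,19,55); (40,79,64); (34,30,20); (28,22,101); (11,93,86); (56,7,48);
  (75,12,81); (67,71,19); (99,55,97); (33,59,36); (61,38,84); (100,50,69);
  (20,32,35); (30,48,75); (45,82,1); (111,54,28); (1,106,89); (36,66,80);
  (10,27,94); (6,8,76); (26,103,78); (57,26,56); (14,20,114); (50,112,103);
  (52,62,68); (37,40,113); (44,35,22); (43,25,57); (38,46,51); (68,77,79);
  (19,43,88); (3,95,13); (25,4,43); (47,99,38); (85,110,34); (109,56,106);
  (15,111,46)], [:: (62,7); (42,15); (35,44); (89,74); (24,91); (23,83);
  (12,108); (114,40)], [:: (90,34); (47,109); (14,92); (49,21); (70,90);
  (99,83); (115,104); (32,36)]);
 (29%nat, 9%nat, [:: (39,63,20); (35,115,19); (28,46,101); (25,110,74);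
  (101,11,25); (33,23,107); (41,101,78); (115,61,92); (11,113,75); (98,13,96);
  (24,31,10); (13,78,1); (110,28,93); (38,53,81); (48,41,4); (17,90,27);
  (23,92,40); (72,5,111); (7,6,22); (36,2,83); (57,8,113); (49,38,68);
  (108,25,8); (10,22,91); (56,107,57); (22,59,108); (53,21,97); (50,89,70);
  (79,35,32); (2,7,6); (3,50,45); (47,85,79); (52,88,61); (27,80,89);
  (21,77,103); (42,108,54); (100,79,55); (31,94,76); (40,36,110); (107,33,21);
  (19,3,94); (20,18,77); (26,54,13); (34,105,2); (46,76,98); (55,96,48);
  (32,91,46)], [:: (62,86); (65,17); (45,35); (73,52); (30,90); (14,9);
  (104,14); (5,88); (112,23)], [:: (11,67); (104,34); (99,55); (16,98);
  (50,65); (43,51); (3,112); (44,48); (64,66)]);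
 (29%nat, 10%nat, [:: (39,63,20); (81,4,32); (106,81,88); (25,110,74);
  (79,27,3); (33,23,107); (43,108,68); (115,61,92); (11,113,75); (98,13,96);
  (14,22,52); (78,104,15); (28,46,12); (53,54,104); (48,41,4); (17,90,27);
  (104,111,14); (72,5,111); (7,6,22); (31,44,113); (5,66,84); (90,99,97);
  (16,106,51); (62,112,11); (114,78,6); (22,59,108); (45,34,23); (50,107,93);
  (4,48,28); (51,68,72); (3,50,45); (47,85,79); (6,69,5); (27,80,89);
  (75,28,54); (80,105,35); (101,19,40); (49,92,36); (40,36,110); (107,33,21);
  (19,3,94); (20,18,77); (86,56,95); (60,11,76); (46,76,98); (55,96,48)], [::
  (59,16); (64,78); (74,59); (34,46); (84,101); (24,55); (93,66); (95,56);
  (103,70); (108,83)], [:: (99,45); (2,47); (19,60); (82,1); (60,37); (71,88);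
  (33,20); (10,2); (81,84); (103,102)]);
 (30%nat, 7%nat, [:: (116,9,49); (48,19,21); (47,29,18); (82,117,12);
  (80,86,2); (45,68,84); (3,80,76); (17,14,68); (29,66,57); (59,63,95);
  (71,43,98); (37,119,50); (41,110,72); (10,11,104); (65,44,24); (7,95,112);
  (15,89,17); (70,98,25); (16,59,118); (28,37,113); (20,100,97); (81,84,79);
  (27,54,53); (99,18,40); (33,20,66); (94,22,86); (51,24,63); (5,70,62);
  (74,5,115); (53,16,44); (34,23,11); (43,69,114); (42,87,100); (13,1,38);
  (23,96,10); (24,76,5); (63,82,15); (19,108,67); (44,115,47); (12,67,46);
  (119,35,61); (11,45,103); (14,46,22); (8,64,14); (35,99,42); (22,55,78);
  (6,116,87); (58,78,96); (54,15,58); (88,74,105); (52,83,41)], [:: (64,111);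
  (36,101); (89,75); (95,7); (102,70); (111,94); (118,8)], [:: (29,114);
  (16,49); (116,21); (85,104); (54,40); (59,52); (119,113)]);
 (30%nat, 8%nat, [:: (38,14,110); (109,93,59); (19,61,75); (17,94,18);
  (56,16,19); (51,38,79); (58,33,55); (76,65,14); (39,75,74); (12,51,91);
  (87,24,7); (7,8,53); (32,100,34); (55,27,15); (22,76,48); (31,44,70);
  (77,99,106); (68,66,51); (75,115,41); (34,45,101); (48,111,102); (20,13,56);
  (28,22,32); (73,11,24); (23,19,76); (25,98,82); (21,107,10); (4,48,81);
  (53,82,62); (26,92,117); (96,101,8); (3,97,26); (27,15,33); (111,18,103);
  (40,3,71); (18,10,16); (49,110,45); (6,106,47); (1,89,97); (110,113,115);
  (8,12,93); (66,68,87); (42,73,84); (37,43,12); (36,64,35); (16,7,65);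
  (50,59,38); (35,52,20); (57,78,25); (15,87,49)], [:: (59,43); (74,99);
  (41,23); (29,46); (14,69); (13,50); (5,52); (2,64)], [:: (119,69); (98,50);
  (67,20); (105,63); (37,74); (78,114); (89,84); (85,81)]);
 (30%nat, 9%nat, [:: (29,58,115); (44,103,57); (64,27,50); (22,54,119);
  (51,70,2); (52,61,55); (16,112,14); (4,35,112); (2,110,40); (13,77,52);
  (55,62,106); (53,59,35); (31,6,116); (6,14,72); (43,63,10); (24,8,46);
  (15,18,44); (39,88,91); (112,93,86); (42,98,87); (50,10,25); (46,19,17);
  (117,73,89); (7,80,38); (95,57,28); (34,28,75); (49,34,33); (32,33,78);
  (92,114,81); (66,79,62); (102,76,103); (19,42,51); (37,5,18); (59,117,99);
  (9,43,84); (106,49,69); (21,25,110); (85,2,39); (11,81,67); (26,50,98);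
  (12,65,16); (17,82,61); (119,47,11); (45,17,21); (73,100,66); (27,68,36);
  (38,15,74); (33,20,100); (84,7,12)], [:: (62,117); (57,68); (48,71); (41,26);
  (80,79); (97,113); (20,15); (10,47); (115,102)], [:: (85,21); (118,64);
  (42,111); (45,84); (109,78); (54,26); (5,24); (111,99); (77,69)]);
 (30%nat, 10%nat, [:: (72,77,16); (44,103,57); (64,27,50); (43,40,35);
  (59,105,103); (52,61,55); (108,54,36); (4,35,112); (2,110,40); (21,23,42);
  (40,26,111); (20,84,15); (5,9,116); (22,65,32); (42,62,118); (27,99,41);
  (15,18,44); (39,88,91); (112,87,119); (31,39,18); (36,117,25); (28,75,22);
  (117,73,89); (7,80,38); (95,57,28); (47,66,110); (13,78,71); (32,33,78);
  (9,43,54); (66,79,62); (62,19,68); (19,42,51); (49,8,33); (6,119,7);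
  (38,55,14); (106,49,69); (41,25,52); (85,2,39); (11,81,67); (26,50,98);
  (10,68,99); (37,22,88); (119,47,11); (23,17,21); (55,15,96); (57,102,6);
  (50,5,27); (33,20,100)], [:: (67,101); (69,93); (46,26); (75,53); (86,61);
  (91,84); (24,115); (102,10); (17,87); (16,109)], [:: (94,37); (29,94);
  (56,4); (12,59); (74,36); (102,16); (86,101); (97,85); (92,82); (85,86)]);
 (31%nat, 7%nat, [:: (60,44,116); (1,75,60); (58,111,23); (107,116,105);
  (44,47,104); (84,90,36); (115,68,21); (23,20,78); (55,110,109); (29,101,71);
  (56,35,1); (118,91,22); (16,99,56); (14,1,43); (78,77,85); (61,112,64);
  (15,103,117); (59,66,48); (111,13,115); (100,82,119); (99,97,113);
  (122,23,20); (49,118,44); (34,64,52); (20,109,17); (36,94,68); (42,52,24);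
  (26,61,67); (52,85,102); (33,74,81); (121,117,34); (53,27,92); (35,25,86);
  (94,45,40); (10,26,90); (48,107,8); (18,12,39); (4,46,91); (5,9,11);
  (45,83,79); (12,92,112); (54,67,107); (50,8,61); (47,49,28); (32,2,12);
  (86,38,19); (28,98,18); (19,33,84); (67,96,63); (43,15,101); (39,86,110);
  (97,5,54); (103,24,15)], [:: (51,50); (41,5); (37,100); (102,57); (11,27);
  (116,87); (117,66)], [:: (99,43); (37,115); (49,10); (73,108); (46,17);
  (95,72); (65,78)]);
 (31%nat, 8%nat, [:: (25,63,7); (47,83,34); (6,57,24); (22,35,76); (91,68,120);
  (10,107,37); (2,25,55); (112,10,65); (36,11,21); (27,88,117); (38,19,54);
  (50,30,5); (48,115,91); (61,96,110); (46,12,94); (89,60,40); (81,114,41);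
  (52,101,96); (8,55,82); (95,110,29); (19,22,118); (11,86,89); (57,13,2);
  (16,102,14); (45,104,121); (53,65,56); (32,14,72); (75,95,45); (7,50,44);
  (41,52,6); (39,118,103); (107,15,63); (58,47,84); (14,71,52); (37,108,10);
  (80,4,112); (73,112,68); (28,105,73); (30,21,122); (69,5,4); (60,6,69);
  (59,23,87); (23,39,123); (5,113,92); (54,81,74); (4,123,1); (15,61,8);
  (20,46,111); (3,103,85); (98,116,30); (56,41,98); (100,1,9)], [:: (42,78);
  (40,42); (34,58); (103,64); (106,114); (111,53); (9,107); (123,66)], [::
  (81,34); (28,73); (102,17); (17,51); (50,72); (83,70); (19,7); (116,120)]);
 (31%nat, 9%nat, [:: (61,37,80); (47,45,59); (16,13,96); (107,60,26);
  (119,61,99); (58,86,35); (78,42,23); (118,7,24); (7,40,116); (14,65,67);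
  (67,6,106); (23,108,39); (8,29,76); (37,47,11); (12,59,50); (2,99,34);
  (25,24,103); (29,66,40); (41,113,29); (45,123,48); (34,115,119); (26,67,54);
  (92,21,56); (60,23,46); (55,25,75); (54,35,117); (40,36,8); (123,51,7);
  (15,106,112); (21,41,36); (30,10,107); (20,5,17); (33,55,115); (28,2,74);
  (80,58,5); (11,81,25); (10,118,27); (53,111,12); (74,117,14); (4,72,118);
  (36,96,86); (49,79,9); (18,89,92); (48,52,82); (105,120,57); (9,122,111);
  (3,4,110); (56,1,2); (52,71,79); (97,103,64); (35,73,89)], [:: (65,16);
  (73,49); (81,73); (82,45); (39,65); (86,95); (100,32); (22,55); (13,61)], [::
  (84,18); (101,44); (18,105); (3,95); (90,119); (44,22); (114,94); (42,57);
  (83,90)]);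
 (31%nat, 10%nat, [:: (7,57,116); (83,11,37); (69,97,59); (99,28,123);
  (59,85,14); (56,27,77); (78,42,23); (118,7,24); (58,121,45); (52,73,12);
  (67,116,103); (26,6,10); (53,68,70); (37,55,11); (24,49,100); (64,16,97);
  (2,119,16); (34,32,54); (35,12,96); (43,118,48); (27,91,42); (107,39,71);
  (73,38,44); (9,18,119); (42,26,17); (112,53,39); (50,25,30); (22,112,3);
  (113,101,66); (39,86,102); (119,29,40); (1,56,114); (40,59,105); (28,2,74);
  (116,103,35); (38,1,46); (18,47,27); (21,100,92); (13,19,83); (120,81,118);
  (36,96,86); (92,48,51); (33,90,115); (48,52,82); (47,67,43); (54,123,32);
  (3,4,110); (30,37,94); (20,22,61); (110,44,113)], [:: (63,121); (75,5);
  (45,68); (80,120); (29,109); (23,36); (105,41); (108,73); (109,72);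
  (114,84)], [:: (38,115); (33,75); (107,66); (81,117); (106,72); (78,106);
  (8,35); (22,10); (67,74); (91,92)]);
 (32%nat, 7%nat, [:: (108,120,11); (45,126,75); (46,87,53); (34,33,51);
  (100,39,18); (49,4,99); (90,76,68); (17,79,108); (35,36,9); (101,10,82);
  (124,117,14); (29,26,118); (16,56,19); (48,6,123); (89,15,46); (2,73,15);
  (37,2,106); (114,81,20); (26,8,116); (25,114,49); (5,125,45); (52,16,6);
  (41,104,119); (51,108,56); (65,103,90); (69,20,25); (42,55,43); (57,107,84);
  (58,118,16); (92,22,44); (19,43,78); (18,121,47); (116,49,7); (47,74,17);
  (119,65,3); (3,83,55); (13,35,124); (1,127,72); (55,38,113); (33,61,105);
  (60,70,117); (54,14,21); (97,63,69); (61,113,34); (62,21,104); (11,47,77);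
  (44,23,39); (121,94,4); (78,62,122); (22,45,31); (85,93,5); (105,68,65);
  (113,51,97); (21,97,98); (56,37,33)], [:: (53,35); (88,59); (98,85);
  (104,29); (10,70); (8,2); (122,48)], [:: (100,41); (42,92); (73,116);
  (26,67); (102,119); (115,124); (30,28)]);
 (32%nat, 10%nat, [:: (12,56,7); (35,68,24); (34,99,114); (27,70,23);
  (61,101,41); (44,47,48); (80,30,113); (13,75,126); (29,88,68); (37,3,60);
  (10,95,28); (11,13,51); (69,111,13); (56,26,9); (102,114,25); (16,120,110);
  (17,31,36); (50,44,109); (28,46,99); (46,112,101); (21,100,82); (74,15,19);
  (120,69,26); (23,52,17); (33,60,53); (49,83,56); (77,42,120); (87,109,75);
  (40,127,54); (39,45,117); (58,22,16); (53,63,103); (42,29,4); (30,10,46);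
  (55,11,52); (22,1,30); (121,76,100); (9,5,21); (36,106,11); (66,74,5);
  (52,91,89); (114,97,88); (57,35,105); (65,17,63); (20,110,58); (4,65,86);
  (31,62,116); (19,54,76); (18,2,102); (25,24,50); (68,105,74); (6,79,121)],
  [:: (81,57); (83,119); (85,55); (90,49); (104,95); (15,81); (5,123);
  (125,38); (126,91); (127,20)], [:: (71,9); (125,77); (1,92); (72,49);
  (47,28); (67,53); (45,58); (15,27); (97,89); (118,121)]);
 (33%nat, 7%nat, [:: (72,14,55); (69,54,90); (7,102,114); (58,44,122);
  (46,68,26); (61,69,87); (57,85,17); (103,116,14); (64,114,77); (37,6,11);
  (4,2,62); (36,51,127); (20,128,103); (78,25,35); (15,12,44); (48,90,75);
  (93,22,31); (28,65,4); (51,61,41); (30,7,125); (26,20,107); (40,52,96);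
  (32,23,81); (94,53,104); (119,126,105); (65,9,68); (56,16,3); (85,4,73);
  (109,130,9); (50,38,85); (1,55,38); (2,59,65); (25,96,70); (62,111,2);
  (16,50,89); (12,17,100); (73,74,45); (101,62,78); (34,80,111); (41,101,98);
  (17,100,47); (21,8,32); (24,60,64); (97,103,63); (22,42,69); (127,105,43);
  (45,127,84); (80,1,58); (43,5,40); (114,41,106); (53,78,128); (42,31,23);
  (8,121,27); (126,82,30); (3,119,97); (49,67,48); (44,24,72)], [:: (77,16);
  (105,19); (113,67); (14,29); (121,86); (122,24); (9,102)], [:: (131,76);
  (39,125); (52,18); (56,84); (80,87); (115,117); (124,123)]);
 (33%nat, 8%nat, [:: (104,17,105); (38,67,128); (39,74,43); (82,56,102);
  (60,28,110); (16,55,38); (119,49,89); (61,101,121); (29,105,64); (34,83,68);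
  (22,38,97); (21,9,8); (62,45,130); (117,98,119); (32,31,96); (57,43,36);
  (23,88,7); (47,122,87); (6,23,101); (17,94,20); (24,91,109); (43,36,23);
  (41,110,2); (102,106,27); (81,37,73); (19,25,37); (58,59,85); (68,44,15);
  (65,117,19); (46,118,58); (31,26,22); (12,107,18); (35,77,83); (53,47,10);
  (52,96,48); (9,63,82); (63,120,56); (48,69,80); (122,76,74); (106,29,116);
  (105,130,81); (55,52,94); (25,51,41); (11,42,111); (90,72,104); (95,61,34);
  (14,46,84); (76,81,53); (87,62,59); (131,92,12); (59,19,24); (129,87,79);
  (8,131,61); (4,121,28); (40,54,70); (54,65,51)], [:: (83,9); (88,103);
  (36,47); (112,60); (114,122); (125,71); (5,46); (130,124)], [:: (78,21);
  (63,7); (50,127); (13,115); (30,5); (91,114); (3,113); (112,103)]);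
 (33%nat, 9%nat, [:: (117,71,79); (45,98,77); (22,48,24); (37,9,49); (1,69,31);
  (41,103,54); (82,57,47); (29,114,51); (63,14,90); (48,17,126); (89,112,48);
  (44,89,82); (31,68,118); (57,46,10); (35,47,127); (90,120,32); (39,67,65);
  (120,90,39); (56,21,110); (10,81,63); (46,75,87); (59,105,44); (60,20,57);
  (104,72,73); (4,126,5); (61,95,17); (20,63,60); (78,65,94); (24,5,14);
  (27,11,42); (58,31,56); (32,110,69); (64,102,40); (52,61,81); (30,119,114);
  (49,56,109); (17,36,96); (36,52,98); (51,55,74); (21,6,2); (124,83,131);
  (55,58,41); (38,96,80); (23,111,18); (16,109,123); (65,28,6); (18,39,124);
  (113,3,61); (79,104,72); (7,18,52); (14,34,64); (25,100,35); (106,82,67);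
  (85,121,76); (2,86,27)], [:: (70,129); (92,111); (98,106); (119,103);
  (121,120); (9,13); (6,130); (127,59); (129,112)], [:: (1,76); (15,70);
  (125,35); (8,43); (128,24); (50,77); (70,44); (115,128); (55,49)]);
 (33%nat, 10%nat, [:: (59,54,64); (121,72,54); (105,62,63); (57,94,27);
  (43,85,14); (20,75,80); (14,114,82); (92,111,109); (9,14,73); (103,58,111);
  (39,9,13); (30,26,70); (96,23,34); (70,108,36); (45,42,58); (19,76,103);
  (88,50,3); (35,112,8); (6,56,79); (41,87,68); (22,53,47); (31,22,86);
  (7,83,117); (21,69,125); (116,45,122); (24,130,104); (37,61,96); (32,24,113);
  (55,21,101); (46,120,9); (3,29,120); (13,128,91); (18,16,52); (84,57,45);
  (52,92,44); (58,86,62); (64,3,84); (115,97,15); (60,36,53); (56,79,39);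
  (98,82,97); (42,71,17); (10,12,21); (4,116,6); (109,67,25); (131,10,30);
  (65,18,93); (25,100,69); (106,52,65); (120,121,18); (2,51,43); (61,96,51);
  (50,37,7); (94,88,95)], [:: (69,107); (54,131); (53,92); (81,72); (83,60);
  (47,16); (28,22); (117,4); (124,110); (127,10)], [:: (118,49); (67,129);
  (121,63); (56,7); (41,127); (20,113); (81,43); (12,119); (88,74); (32,35)]);
 (35%nat, 7%nat, [:: (49,77,6); (67,8,82); (62,54,133); (107,28,26);
  (3,107,21); (68,58,136); (8,134,53); (86,52,7); (102,87,134); (1,44,32);
  (51,2,101); (85,82,115); (29,67,139); (12,115,48); (7,92,55); (59,64,84);
  (6,65,80); (13,130,17); (17,57,9); (34,1,10); (58,42,14); (10,47,65);
  (120,93,118); (53,94,19); (46,112,23); (126,19,110); (122,125,68);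
  (61,62,30); (37,81,18); (96,85,108); (104,20,100); (40,23,67); (16,76,54);
  (63,114,97); (71,21,76); (21,46,96); (24,73,119); (97,9,45); (65,63,71);
  (32,56,46); (109,90,89); (5,69,83); (11,103,50); (9,108,111); (27,3,22);
  (115,128,12); (22,51,62); (30,99,128); (93,113,79); (19,66,36); (90,72,114);
  (76,118,16); (138,91,87); (136,131,75); (48,10,31); (23,111,127);
  (41,139,57); (42,100,95); (57,129,86); (52,43,74); (114,122,34)], [::
  (66,27); (60,39); (56,63); (45,94); (101,2); (28,15); (125,11)], [:: (77,13);
  (73,33); (112,11); (109,83); (120,133); (4,137); (78,84)]);
 (35%nat, 8%nat, [:: (92,48,87); (90,15,121); (59,33,46); (25,63,91);
  (21,30,40); (28,61,106); (100,104,25); (113,81,133); (10,87,81); (56,111,12);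
  (14,46,58); (99,79,2); (13,129,39); (4,5,79); (78,23,92); (65,1,47);
  (52,74,103); (34,93,50); (57,42,129); (51,139,18); (60,88,97); (42,132,139);
  (108,124,60); (26,119,136); (44,11,78); (53,102,19); (3,17,44); (8,25,30);
  (77,131,117); (22,95,113); (58,103,71); (43,137,72); (24,39,101); (29,4,128);
  (31,84,104); (5,114,118); (125,27,6); (72,109,124); (107,69,43); (38,32,83);
  (66,56,20); (104,59,11); (23,85,3); (69,82,119); (47,83,75); (139,125,23);
  (30,128,131); (94,10,52); (124,121,74); (55,38,110); (20,89,29); (54,64,66);
  (64,6,122); (61,112,21); (6,118,8); (95,3,89); (133,60,61); (123,67,100);
  (18,49,26); (39,138,57)], [:: (73,41); (91,5); (37,27); (121,34); (12,127);
  (11,68); (9,132); (2,64)], [:: (63,7); (135,80); (80,36); (86,126); (24,133);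
  (111,86); (138,116); (7,136)]);
 (35%nat, 9%nat, [:: (28,123,131); (38,97,88); (16,62,32); (57,58,91);
  (8,30,13); (52,14,101); (79,100,15); (42,29,98); (6,11,12); (32,51,117);
  (53,131,49); (76,118,96); (69,133,56); (9,72,87); (89,59,73); (37,45,123);
  (77,26,67); (111,92,2); (2,96,85); (17,121,45); (58,47,28); (50,132,107);
  (41,23,10); (33,117,69); (109,21,50); (110,69,128); (47,67,33); (34,61,108);
  (62,71,6); (36,112,115); (25,102,7); (26,77,23); (40,119,92); (121,113,133);
  (20,68,61); (46,90,111); (135,115,139); (10,27,130); (68,106,26);
  (43,22,118); (44,1,39); (133,55,86); (81,44,100); (101,138,55); (49,43,4);
  (14,54,3); (21,101,29); (27,139,116); (137,33,43); (66,63,75); (56,25,41);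
  (67,40,34); (22,80,54); (11,64,18); (23,53,11); (4,87,14); (54,39,57);
  (75,99,135); (92,17,66)], [:: (80,31); (55,93); (95,71); (24,106); (18,126);
  (15,81); (127,60); (128,25); (1,16)], [:: (74,13); (136,48); (68,111);
  (124,24); (72,104); (114,2); (47,42); (138,134); (90,88)]);
 (35%nat, 10%nat, [:: (120,126,124); (79,87,47); (81,59,38); (10,51,27);
  (95,100,26); (7,121,103); (6,10,109); (73,33,119); (77,137,25); (38,50,96);
  (34,19,63); (119,134,39); (69,101,33); (25,113,24); (13,30,99); (36,45,104);
  (5,28,77); (33,22,10); (86,24,138); (51,135,2); (93,27,36); (14,7,71);
  (12,79,46); (113,31,83); (65,48,53); (97,18,95); (50,102,37); (22,3,45);
  (23,98,90); (3,133,134); (83,69,89); (87,94,21); (18,36,14); (30,25,56);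
  (98,39,73); (64,61,13); (85,14,127); (49,37,92); (32,82,107); (58,122,11);
  (66,62,68); (29,11,1); (92,1,44); (80,53,16); (56,78,48); (4,124,42);
  (19,120,40); (9,63,86); (37,119,57); (41,13,30); (8,84,131); (46,65,62);
  (1,118,65); (26,81,66); (2,99,43); (101,55,116); (96,95,108); (28,56,72)],
  [:: (68,115); (78,132); (88,93); (40,106); (31,111); (116,85); (17,102);
  (124,91); (125,34); (11,20)], [:: (31,114); (98,8); (29,130); (87,125);
  (80,116); (3,111); (51,32); (59,73); (79,90); (110,106)]);
 (36%nat, 7%nat, [:: (16,84,44); (21,4,75); (22,118,41); (39,73,118);
  (54,139,10); (134,46,130); (33,35,136); (26,129,63); (77,67,42); (32,63,122);
  (138,131,79); (7,128,126); (113,62,138); (47,97,4); (35,78,48); (12,52,51);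
  (126,56,143); (65,80,88); (1,7,113); (91,136,11); (63,34,12); (43,30,67);
  (52,47,13); (78,117,64); (95,3,58); (45,123,27); (19,66,101); (15,76,140);
  (20,49,32); (2,40,8); (44,127,62); (13,122,22); (133,69,110); (88,111,57);
  (37,91,111); (141,96,35); (46,21,26); (5,138,25); (68,59,66); (48,94,24);
  (57,116,89); (29,27,30); (14,42,19); (59,114,124); (106,31,17); (116,132,76);
  (24,89,95); (34,141,132); (50,53,100); (103,75,114); (64,134,1); (71,92,141);
  (102,83,104); (119,8,20); (27,41,37); (8,61,123); (4,22,91); (62,133,105);
  (86,44,77); (9,14,60); (61,110,94); (17,26,112); (75,48,90)], [:: (70,86);
  (60,120); (55,84); (93,92); (40,97); (30,98); (23,129)], [:: (7,88);
  (87,137); (106,77); (128,102); (82,58); (81,99); (73,86)]);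
 (36%nat, 10%nat, [:: (33,128,82); (41,140,17); (30,115,87); (19,129,9);
  (67,9,111); (37,118,103); (2,40,37); (3,15,105); (121,27,83); (14,84,5);
  (24,39,4); (54,17,40); (75,24,44); (31,8,60); (22,110,120); (131,104,19);
  (49,125,132); (134,37,101); (25,73,104); (26,25,68); (32,105,109); (38,94,8);
  (51,20,14); (15,48,46); (4,46,137); (71,55,133); (43,100,16); (9,63,136);
  (39,61,27); (42,16,134); (68,3,135); (17,91,129); (16,82,34); (70,64,7);
  (56,58,13); (50,78,62); (65,123,106); (44,119,49); (64,74,123); (57,96,71);
  (78,1,131); (124,43,32); (133,69,98); (55,2,65); (123,141,122); (83,23,78);
  (60,13,125); (29,88,21); (27,30,112); (35,7,29); (104,99,31); (46,87,100);
  (8,6,53); (7,4,45); (99,47,52); (48,19,69); (85,86,119); (6,95,96);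
  (47,33,6); (34,60,90)], [:: (63,114); (62,55); (58,35); (53,25); (52,127);
  (116,61); (126,124); (132,64); (139,126); (1,23)], [:: (51,126); (94,11);
  (77,26); (24,68); (30,70); (11,50); (43,80); (140,122); (102,93); (20,28)]);
 (37%nat, 7%nat, [:: (45,23,109); (47,96,135); (122,42,52); (105,134,125);
  (40,50,25); (139,137,108); (60,116,21); (100,67,46); (2,3,30); (4,77,122);
  (72,9,140); (107,92,69); (42,7,117); (109,82,89); (27,44,87); (89,24,4);
  (130,13,104); (69,48,145); (71,15,102); (62,55,66); (82,106,5); (6,39,79);
  (11,130,57); (7,79,112); (91,18,132); (52,102,84); (85,136,2); (147,58,106);
  (90,40,124); (34,57,63); (5,108,27); (120,72,67); (73,85,116); (56,100,58);
  (53,91,6); (93,38,64); (46,12,40); (49,125,138); (94,126,8); (129,69,101);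
  (81,70,142); (31,14,18); (33,21,86); (50,132,80); (113,112,19); (13,52,96);
  (65,11,3); (51,113,42); (124,144,90); (15,138,139); (68,17,41); (36,45,61);
  (16,115,26); (14,59,13); (64,80,14); (38,49,71); (123,93,128); (23,104,107);
  (70,123,65); (44,1,70); (126,56,134); (17,127,15); (12,47,28); (145,140,48);
  (140,35,95)], [:: (87,36); (116,55); (118,60); (119,7); (21,120); (20,47);
  (138,144)], [:: (77,145); (91,141); (130,81); (22,129); (34,19); (54,66);
  (129,131)]);
 (37%nat, 8%nat, [:: (90,79,100); (15,95,76); (20,40,145); (12,3,89);
  (98,103,87); (16,14,8); (96,64,72); (76,105,3); (42,92,126); (51,86,97);
  (25,31,88); (138,122,70); (40,73,47); (80,26,127); (70,102,114); (29,16,119);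
  (49,19,82); (14,83,122); (73,139,59); (104,119,128); (131,106,11); (7,65,96);
  (124,91,30); (18,45,103); (9,76,141); (28,1,129); (47,110,44); (46,29,73);
  (116,51,23); (63,109,134); (57,70,65); (8,42,2); (19,123,101); (5,12,39);
  (11,60,4); (122,121,9); (2,112,130); (142,48,24); (36,144,75); (22,32,81);
  (64,22,52); (109,104,107); (43,99,64); (88,133,60); (45,96,138);
  (145,117,140); (23,135,1); (30,66,12); (66,114,25); (61,116,40);
  (56,118,125); (41,94,109); (113,129,78); (13,98,38); (48,62,61); (21,49,99);
  (62,38,71); (71,67,77); (67,52,84); (4,97,19); (59,2,79); (114,58,113);
  (93,43,26); (79,100,102)], [:: (83,22); (94,105); (53,43); (110,18);
  (115,17); (117,41); (27,142); (1,42)], [:: (86,5); (68,4); (136,36);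
  (90,131); (95,57); (117,88); (31,18); (57,53)]);
 (37%nat, 9%nat, [:: (56,97,112); (30,61,32); (54,46,88); (64,128,12);
  (55,77,142); (39,107,101); (141,91,21); (58,120,66); (22,49,8); (80,127,135);
  (81,125,76); (108,63,5); (65,117,92); (43,122,56); (20,16,73); (53,22,146);
  (52,29,19); (145,99,6); (112,36,23); (4,103,87); (63,78,139); (14,38,81);
  (19,89,61); (99,141,65); (78,136,90); (42,31,110); (103,5,133); (18,35,123);
  (28,142,94); (119,137,75); (66,86,131); (59,11,13); (34,70,147);
  (124,133,60); (131,26,7); (73,124,106); (62,110,63); (71,100,78);
  (122,19,53); (57,43,10); (16,131,124); (10,50,67); (13,90,38); (44,139,59);
  (25,39,83); (88,47,136); (6,17,127); (27,132,109); (46,95,126); (2,6,118);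
  (1,144,130); (41,21,85); (116,52,91); (15,112,121); (5,94,2); (51,85,120);
  (21,18,113); (11,130,129); (12,98,35); (79,109,82); (35,51,39);
  (100,146,141); (50,119,122)], [:: (76,116); (61,93); (101,26); (110,33);
  (33,25); (117,104); (23,1); (139,55); (140,80)], [:: (57,138); (132,81);
  (108,10); (54,14); (138,20); (28,54); (96,75); (71,60); (3,147)]);
 (37%nat, 10%nat, [:: (120,123,36); (3,56,106); (85,23,75); (14,69,142);
  (19,20,139); (23,1,49); (83,38,98); (59,36,72); (99,60,18); (86,121,52);
  (44,102,101); (47,18,143); (70,115,2); (72,112,11); (25,51,131); (39,46,41);
  (52,14,69); (11,131,97); (54,82,122); (15,40,42); (57,78,54); (68,134,78);
  (38,72,104); (97,32,39); (67,113,19); (55,30,43); (20,127,24); (34,130,73);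
  (106,6,31); (32,8,90); (5,126,100); (56,61,137); (108,116,51); (4,132,47);
  (50,83,71); (75,105,84); (17,84,64); (41,146,118); (16,109,50); (13,29,68);
  (8,99,61); (53,85,102); (6,71,13); (58,25,29); (46,45,140); (48,33,79);
  (27,143,135); (26,139,136); (45,5,138); (22,19,38); (130,70,80);
  (138,122,44); (30,147,15); (77,97,127); (43,52,85); (136,140,23); (36,22,99);
  (113,41,27); (21,3,14); (9,79,146); (61,124,17); (69,125,81)], [:: (66,6);
  (64,112); (88,57); (115,59); (31,12); (119,89); (124,77); (7,82); (146,22);
  (147,141)], [:: (60,144); (114,28); (62,11); (10,59); (87,44); (92,65);
  (129,107); (94,76); (144,135); (95,89)]);
 (39%nat, 9%nat, [:: (19,10,85); (65,67,107); (58,135,151); (32,153,24);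
  (34,89,103); (70,19,92); (55,91,1); (45,88,35); (40,90,49); (20,37,94);
  (150,25,109); (110,125,126); (82,36,70); (21,114,116); (51,122,28);
  (125,113,142); (23,85,63); (42,62,74); (93,99,82); (134,118,54); (3,68,16);
  (147,123,143); (144,92,99); (47,30,148); (28,72,40); (129,141,53);
  (75,127,101); (66,130,125); (115,96,11); (50,82,13); (4,132,155); (83,65,34);
  (113,63,3); (11,38,145); (16,128,14); (64,8,88); (127,137,46); (67,2,58);
  (120,87,41); (5,84,102); (69,142,22); (95,29,115); (33,100,87); (146,28,25);
  (131,55,45); (1,31,113); (96,58,95); (62,138,119); (57,21,84); (26,5,146);
  (13,6,134); (38,149,18); (24,71,150); (48,131,42); (56,104,60); (72,79,133);
  (18,3,61); (59,33,66); (49,45,96); (35,15,19); (2,110,75); (30,53,154);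
  (119,60,69); (15,48,56); (54,143,37); (7,64,21); (88,56,26)], [:: (79,9);
  (80,81); (85,129); (103,114); (52,86); (112,5); (17,98); (142,4); (8,59)],
  [:: (68,129); (8,105); (131,23); (51,98); (153,108); (127,103); (29,50);
  (72,83); (122,116)]);
 (39%nat, 10%nat, [:: (69,141,142); (50,52,121); (95,31,19); (59,107,97);
  (94,26,149); (126,56,30); (23,138,77); (51,126,145); (10,144,3); (104,7,66);
  (3,46,54); (46,18,131); (155,44,47); (73,142,120); (40,30,83); (135,28,82);
  (123,127,96); (7,143,34); (41,15,137); (88,97,20); (76,33,60); (112,70,56);
  (72,49,141); (19,77,143); (31,147,103); (71,9,154); (2,65,24); (27,134,152);
  (102,116,144); (13,12,21); (99,154,122); (67,98,26); (49,74,150); (82,17,38);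
  (9,37,108); (34,136,68); (86,109,36); (43,123,110); (53,32,8); (8,108,7);
  (77,68,74); (66,137,29); (63,105,67); (48,53,51); (22,87,17); (37,50,33);
  (96,13,62); (150,5,70); (55,145,12); (127,6,104); (42,57,53); (65,35,140);
  (75,139,89); (138,91,46); (145,16,52); (12,150,93); (56,93,118); (136,128,1);
  (58,25,32); (36,121,81); (38,82,124); (25,66,61); (130,148,132); (4,102,139);
  (5,104,84); (35,114,10)], [:: (64,153); (109,119); (45,106); (32,127);
  (28,87); (132,16); (139,129); (16,40); (141,105); (142,76)], [:: (95,20);
  (111,29); (125,58); (112,19); (22,84); (50,110); (101,1); (151,41); (57,92);
  (6,132)]);
 (45%nat, 33%nat, [:: (60,83,64); (28,10,56); (47,138,115); (86,149,66);
  (74,73,10); (84,20,119); (85,163,11); (7,134,59); (55,110,1); (65,27,99);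
  (2,70,114); (149,39,51); (32,117,176); (70,77,9); (122,156,8); (78,118,166);
  (64,84,67); (6,81,128); (100,146,31); (59,17,121); (52,87,25); (113,16,103);
  (147,150,144); (29,41,129); (14,71,150); (63,167,71); (35,140,160);
  (37,102,73); (179,101,24); (44,131,94); (40,78,88); (93,9,165); (156,69,158);
  (51,5,112); (56,176,30); (158,171,169); (19,40,14); (68,137,18);
  (50,104,143); (25,148,152); (36,30,157); (42,178,145); (34,173,60);
  (26,58,15); (72,164,84); (27,109,151); (9,85,47); (81,114,113); (79,174,100);
  (23,145,170); (16,96,178); (4,159,137); (66,152,163); (30,59,74);
  (69,13,133)], [:: (91,39); (88,106); (83,2); (98,172); (77,156); (76,61);
  (105,48); (73,149); (109,44); (118,164); (61,49); (123,101); (54,97);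
  (53,16); (131,43); (48,77); (46,140); (43,118); (41,22); (39,147); (38,89);
  (21,27); (160,4); (18,125); (163,5); (15,72); (167,41); (168,167); (169,146);
  (10,17); (172,81); (175,42); (3,58)], [:: (109,23); (110,15); (37,139);
  (28,98); (132,63); (52,166); (131,67); (107,49); (19,142); (98,42); (26,151);
  (159,105); (108,56); (148,19); (141,91); (168,37); (161,120); (173,33);
  (177,141); (130,95); (117,86); (50,80); (154,1); (153,132); (111,129);
  (171,155); (79,65); (126,113); (62,53); (6,14); (53,60); (36,31); (175,172)]);
 (51%nat, 10%nat, [:: (77,4,181); (62,43,103); (78,10,106); (30,69,116);
  (71,128,109); (42,32,78); (21,177,71); (15,3,150); (159,171,122);
  (52,166,94); (75,144,70); (145,173,162); (3,87,37); (38,88,87); (93,125,151);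
  (67,83,22); (26,189,182); (1,139,141); (109,115,179); (49,97,198); (18,5,2);
  (143,40,5); (14,27,127); (86,53,65); (29,175,42); (94,25,92); (151,95,73);
  (84,120,175); (25,14,139); (182,158,74); (31,30,24); (66,110,158);
  (12,80,97); (106,147,18); (24,132,45); (65,186,176); (43,203,67); (73,55,85);
  (172,192,183); (63,101,35); (36,45,130); (44,142,1); (17,150,56);
  (13,109,76); (35,8,124); (9,134,155); (96,195,77); (47,106,164); (91,154,55);
  (48,160,129); (185,74,46); (50,194,111); (56,103,33); (10,72,137);
  (4,170,128); (76,165,52); (58,198,157); (112,152,134); (116,169,117);
  (68,143,187); (199,191,11); (23,138,82); (188,15,60); (117,82,95);
  (27,57,149); (122,44,170); (100,123,152); (41,107,189); (34,60,17);
  (80,18,54); (89,118,49); (79,93,200); (165,47,123); (8,108,145); (20,78,118);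
  (74,54,15); (72,46,105); (167,151,27); (99,90,167); (7,172,91); (69,179,199);
  (64,184,34); (6,9,43); (123,133,19); (97,67,83); (55,23,132); (134,131,154);
  (40,26,119); (121,7,80); (119,19,72)], [:: (103,4); (90,79); (144,173);
  (57,113); (150,8); (158,25); (171,168); (176,7); (11,147); (2,143)], [::
  (81,196); (64,2); (197,31); (161,129); (21,200); (88,73); (61,75); (202,6);
  (107,112); (159,155)])
].

(* A row (t, u, fin, iw, im) yields a frame of type 2^t u^1. *)
Definition families2 : seq difference_family :=
[::
 (4%nat, 1%nat, [:: (1,6,3); (5,3,2)], [:: (6,7)], [:: (1,7)]);
 (4%nat, 2%nat, [:: (1,2,7)], [:: (6,5); (3,6)], [:: (2,1); (3,5)]);
 (4%nat, 3%nat, [::], [:: (2,7); (1,3); (3,2)], [:: (5,6); (6,1); (1,3)])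
].

(* A frame of type 2^4 with holes {0,1}, {2,3}, {4,5}, {6,7}; no such frame is
   invariant under Z_8. *)
Definition frame_2_4_0_matches : seq (N * N * N * N) :=
 [:: (2,4,7,1); (4,6,3,1); (6,2,5,1); (3,6,5,0); (5,2,7,0); (7,4,3,0);
  (2,7,4,0); (4,3,6,0); (6,5,2,0); (2,1,5,7); (4,1,7,3); (6,1,3,5); (0,6,2,5);
  (0,2,4,7); (0,4,6,3); (0,7,3,4); (0,3,5,6); (0,5,7,2); (1,5,3,7); (1,7,5,3);
  (1,3,7,5); (1,4,2,6); (1,6,4,2); (1,2,6,4)].

(* A row (n, k, s) is a CMDRR(n,k) in which players i < k have spouses, and the
   exceptional pairs are {k,k+1}, {k+2,k+3} and so on. *)
Definition small_tournaments : seq (nat * nat * seq (N * N * N * N)) :=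
[::
 (0%nat, 0%nat, [::]);
 (1%nat, 1%nat, [::]);
 (4%nat, 0%nat, [:: (0,1,3,0); (1,0,2,1); (0,2,2,3); (0,3,1,1); (2,0,3,3);
  (2,2,3,1); (1,3,3,2); (0,0,1,2)]);
 (4%nat, 4%nat, [:: (0,3,1,2); (2,1,3,0); (0,1,2,3); (1,0,3,2); (0,2,3,1);
  (1,3,2,0)]);
 (7%nat, 1%nat, [:: (1,4,2,3); (1,2,3,1); (3,2,5,5); (2,1,4,2); (3,5,4,3);
  (0,3,5,1); (0,4,3,3); (0,1,2,5); (4,1,5,6); (0,5,1,6); (1,5,2,6); (0,6,6,2);
  (5,4,6,5); (5,3,6,6); (2,2,6,3); (1,1,6,4); (3,4,4,6); (0,2,4,4); (4,5,6,0);
  (3,0,6,1); (1,0,5,2); (1,3,4,0); (2,4,5,0); (2,0,3,6)]);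
 (7%nat, 3%nat, [:: (1,0,3,2); (1,2,5,4); (1,6,4,5); (4,6,5,2); (2,6,3,4);
  (4,0,6,4); (3,5,6,2); (5,6,6,0); (1,5,2,0); (1,3,6,6); (2,5,4,3); (2,3,5,0);
  (3,3,4,4); (0,3,1,4); (0,4,5,5); (0,5,3,6); (0,2,6,3); (2,4,6,1); (5,1,6,5);
  (0,6,2,1); (3,1,5,3); (3,0,4,1); (0,1,4,2)]);
 (7%nat, 5%nat, [:: (4,5,5,0); (3,6,5,5); (1,5,4,6); (2,6,3,0); (1,0,3,4);
  (1,4,2,5); (5,6,6,1); (2,4,6,6); (2,0,5,1); (3,2,4,1); (1,2,6,0); (3,5,6,2);
  (5,3,6,4); (2,1,4,3); (1,3,5,2); (4,0,6,3); (0,1,6,5); (0,6,4,2); (0,3,1,6);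
  (0,2,5,4); (0,5,2,3); (0,4,3,1)]);
 (7%nat, 7%nat, [:: (3,4,6,1); (1,2,4,5); (4,0,6,5); (2,1,6,0); (0,3,4,1);
  (2,0,4,3); (1,5,6,3); (0,4,3,5); (2,5,3,1); (1,0,3,2); (0,2,6,4); (3,6,4,2);
  (0,5,2,6); (5,3,6,2); (3,0,5,6); (0,1,5,2); (4,6,5,1); (1,4,5,0); (1,6,2,4);
  (2,3,5,4); (0,6,1,3)]);
 (8%nat, 0%nat, [:: (5,6,7,0); (5,1,6,6); (4,0,6,1); (2,5,6,2); (1,6,4,5);
  (1,2,5,7); (1,0,2,1); (4,7,5,0); (0,2,6,0); (0,1,7,5); (0,7,2,6); (0,6,1,7);
  (2,7,4,4); (6,4,7,6); (6,5,7,7); (2,4,5,5); (4,2,7,4); (0,4,1,1); (1,4,6,3);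
  (1,3,7,2); (4,1,5,3); (0,3,5,2); (0,5,4,3); (2,0,7,3); (1,5,3,0); (2,3,3,6);
  (2,2,3,1); (0,0,3,4); (3,3,6,7); (3,7,7,1); (3,2,4,6); (3,5,5,4)]);
 (8%nat, 2%nat, [:: (1,7,4,2); (2,2,3,5); (1,2,2,3); (2,7,7,0); (1,0,7,4);
  (2,0,3,3); (2,5,4,4); (1,5,6,0); (3,4,6,3); (1,4,3,6); (4,6,7,3); (3,2,7,6);
  (2,6,6,7); (4,7,6,4); (0,7,1,6); (0,3,6,2); (0,4,7,5); (0,5,3,7); (4,0,5,2);
  (4,5,5,6); (5,3,7,7); (0,2,5,4); (1,3,5,5); (5,0,6,6); (2,4,5,1); (6,1,7,2);
  (6,5,7,1); (3,1,5,7); (0,1,4,3); (0,6,2,1); (3,0,4,1)]);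
 (8%nat, 4%nat, [:: (1,6,2,3); (2,6,6,0); (0,4,7,6); (6,3,7,4); (1,4,5,0);
  (2,5,5,3); (4,0,7,3); (0,7,1,3); (2,0,4,5); (4,7,6,6); (1,5,6,4); (5,7,7,0);
  (0,6,5,5); (1,7,4,6); (0,1,2,4); (4,3,5,1); (6,5,7,1); (2,1,7,7); (5,2,6,7);
  (0,3,6,2); (4,2,5,4); (1,2,7,5); (0,2,4,1); (3,5,4,4); (3,6,7,2); (0,5,3,7);
  (3,1,5,6); (2,7,3,4); (1,0,3,2); (3,0,6,1)]);
 (8%nat, 6%nat, [:: (3,7,7,1); (2,5,6,1); (4,7,6,6); (3,2,6,5); (2,6,7,5);
  (4,5,7,7); (0,2,4,6); (6,3,7,6); (0,3,6,7); (4,1,5,3); (0,6,2,1); (3,1,4,2);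
  (2,0,4,3); (5,0,7,2); (2,7,3,0); (5,1,6,0); (0,7,5,2); (0,1,7,4); (3,4,5,6);
  (0,4,3,5); (6,4,7,0); (2,3,5,4); (1,2,7,3); (0,5,1,3); (1,4,6,2); (1,6,5,7);
  (1,7,2,4); (1,5,4,0); (1,0,3,6)]);
 (8%nat, 8%nat, [:: (3,7,6,4); (2,7,3,0); (5,3,6,0); (3,4,7,5); (3,2,5,0);
  (4,2,6,5); (2,0,4,5); (1,5,6,7); (1,7,5,2); (1,4,2,3); (1,0,7,4); (4,1,5,7);
  (2,4,5,1); (2,1,6,3); (6,1,7,0); (4,3,7,2); (2,5,7,6); (3,1,4,6); (1,2,3,6);
  (1,6,4,0); (5,6,7,3); (0,5,1,3); (0,4,6,2); (0,6,5,4); (0,2,7,1); (0,3,4,7);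
  (0,7,2,6); (0,1,3,5)]);
 (9%nat, 1%nat, [:: (2,7,6,1); (4,5,8,3); (0,3,5,7); (0,1,7,5); (5,5,6,6);
  (7,7,8,8); (0,8,6,2); (0,6,8,4); (5,3,6,4); (7,1,8,2); (1,8,4,4); (3,6,2,2);
  (0,2,1,3); (0,4,3,1); (5,0,8,5); (7,0,6,7); (0,5,2,8); (0,7,4,6); (2,4,8,7);
  (4,2,6,5); (2,0,5,2); (4,0,7,4); (1,1,6,0); (3,3,8,0); (1,4,2,5); (3,2,4,7);
  (1,0,2,6); (3,0,4,8); (1,2,8,1); (3,4,6,3); (1,6,7,3); (3,8,5,1); (1,7,5,8);
  (3,5,7,6); (2,3,7,8); (4,1,5,6); (6,8,8,6); (5,4,7,2); (1,5,3,7); (2,1,4,3)]);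
 (9%nat, 3%nat, [:: (0,8,2,3); (3,8,4,1); (4,5,5,3); (2,5,3,6); (0,4,5,6);
  (0,5,6,1); (0,1,4,4); (0,6,3,5); (4,7,6,6); (5,1,6,3); (2,1,5,7); (3,3,6,7);
  (2,8,6,4); (5,8,8,6); (2,4,8,5); (4,3,8,4); (0,7,7,8); (7,6,8,1); (3,4,7,3);
  (5,5,7,7); (3,0,4,8); (2,0,7,1); (6,5,8,0); (2,7,4,0); (7,0,8,3); (3,1,8,2);
  (5,2,6,8); (4,6,7,2); (0,2,8,7); (6,2,7,4); (3,2,5,0); (1,4,3,7); (1,5,4,2);
  (1,0,5,4); (1,6,6,0); (1,7,8,8); (1,8,7,5); (0,3,1,2); (1,3,2,6)]);
 (9%nat, 5%nat, [:: (2,5,4,3); (1,5,2,7); (1,0,8,3); (2,4,7,0); (1,7,4,6);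
  (4,7,7,3); (7,5,8,6); (2,1,8,4); (7,7,8,0); (2,3,5,6); (1,4,6,5); (6,3,7,1);
  (5,5,6,0); (2,0,3,1); (3,7,5,4); (3,6,8,5); (4,0,6,6); (5,7,6,1); (2,6,6,8);
  (4,8,8,1); (1,8,3,0); (5,3,8,8); (3,8,6,7); (5,8,7,4); (4,2,5,0); (1,6,5,2);
  (3,5,7,2); (1,2,7,8); (3,2,4,1); (6,4,8,2); (0,6,3,4); (0,2,8,7); (0,1,7,6);
  (0,5,5,1); (0,7,2,8); (0,4,1,3); (0,8,4,5); (0,3,6,2)]);
 (9%nat, 7%nat, [:: (0,6,1,3); (1,0,2,4); (2,1,3,5); (3,2,4,6); (4,3,5,0);
  (5,4,6,1); (6,5,0,2); (0,5,8,6); (1,6,8,0); (2,0,8,1); (3,1,8,2); (4,2,8,3);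
  (5,3,8,4); (6,4,8,5); (0,7,3,4); (1,7,4,5); (2,7,5,6); (3,7,6,0); (4,7,0,1);
  (5,7,1,2); (6,7,2,3); (0,4,7,2); (1,5,7,3); (2,6,7,4); (3,0,7,5); (4,1,7,6);
  (5,2,7,0); (6,3,7,1); (0,3,2,8); (1,4,3,8); (2,5,4,8); (3,6,5,8); (4,0,6,8);
  (5,1,0,8); (6,2,1,8); (7,7,8,8); (7,8,8,7)]);
 (9%nat, 9%nat, [:: (4,7,6,0); (4,8,7,3); (6,1,8,3); (2,0,6,8); (2,1,4,6);
  (3,0,5,1); (4,0,8,5); (2,8,3,5); (2,3,7,0); (4,1,5,8); (3,7,8,6); (3,1,7,5);
  (2,5,8,7); (1,5,7,6); (1,7,4,3); (1,6,8,0); (3,8,6,4); (1,3,2,4); (1,4,6,5);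
  (1,8,5,7); (5,0,7,4); (2,6,5,4); (0,1,2,7); (0,3,5,6); (0,4,8,1); (0,7,3,4);
  (0,6,7,8); (0,5,6,3); (1,0,3,2); (5,2,6,7); (0,8,1,2); (7,2,8,4); (3,6,4,2);
  (5,3,8,2); (0,2,4,5); (6,2,7,1)]);
 (10%nat, 0%nat, [:: (4,5,5,9); (6,7,7,9); (4,3,7,7); (6,1,5,5); (4,9,5,1);
  (6,9,7,3); (4,2,8,3); (6,0,8,1); (5,6,8,7); (7,4,8,5); (0,7,8,4); (2,5,8,6);
  (0,4,9,5); (2,6,9,7); (0,6,7,2); (2,4,5,0); (0,5,4,0); (2,7,6,2); (4,7,9,0);
  (6,5,9,2); (5,3,9,6); (7,1,9,4); (0,0,1,9); (2,2,3,9); (0,1,1,7); (2,3,3,5);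
  (1,0,6,6); (3,2,4,4); (0,9,3,6); (2,9,1,4); (1,2,9,3); (3,0,9,1); (1,3,5,4);
  (3,1,7,6); (1,1,8,2); (3,3,8,0); (1,6,4,8); (3,4,6,8); (0,8,6,3); (2,8,4,1);
  (0,2,5,8); (2,0,7,8); (1,8,7,5); (3,8,5,7); (5,2,7,0); (4,6,6,4); (0,3,2,1);
  (1,5,3,7); (8,8,9,9); (8,9,9,8)]);
 (10%nat, 2%nat, [:: (3,5,6,0); (6,2,7,6); (1,8,6,3); (6,8,8,0); (3,3,8,6);
  (4,3,7,0); (4,0,8,2); (1,5,7,2); (3,8,4,4); (1,6,4,5); (3,6,5,8); (1,0,5,6);
  (5,2,6,4); (3,4,7,5); (4,7,5,5); (1,7,3,9); (1,2,8,7); (7,9,8,8); (5,7,7,8);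
  (2,2,5,9); (2,7,6,6); (2,3,3,2); (2,0,7,7); (2,9,3,0); (1,3,2,4); (2,8,9,5);
  (6,7,9,3); (8,9,9,6); (7,3,9,9); (4,6,9,7); (4,9,5,4); (8,5,9,4); (1,4,9,0);
  (0,5,5,3); (0,4,2,6); (0,2,9,8); (0,8,1,9); (0,9,6,5); (0,7,8,4); (0,3,4,2);
  (5,1,8,3); (0,1,3,7); (6,1,7,4); (2,1,4,8); (3,1,9,2); (2,5,8,1); (4,1,6,9);
  (0,6,7,1); (5,0,9,1)]);
 (10%nat, 4%nat, [:: (0,4,8,5); (1,6,8,7); (0,6,7,9); (1,4,5,9); (5,5,9,6);
  (7,7,9,4); (5,7,8,2); (7,5,8,3); (0,3,5,6); (1,2,7,4); (0,9,4,7); (1,9,6,5);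
  (4,5,5,4); (6,7,7,6); (4,2,9,5); (6,3,9,7); (4,3,8,1); (6,2,8,0); (0,1,9,2);
  (1,0,9,3); (0,5,6,1); (1,7,4,0); (2,3,6,4); (3,2,4,6); (2,9,7,3); (3,9,5,2);
  (2,7,5,1); (3,5,7,0); (2,1,8,6); (3,0,8,4); (2,0,4,9); (3,1,6,9); (2,6,9,0);
  (3,4,9,1); (0,8,2,4); (1,8,3,6); (0,7,3,8); (1,5,2,8); (4,1,7,8); (6,0,5,8);
  (4,8,5,3); (6,8,7,2); (4,4,6,6); (0,2,1,3); (5,0,7,1); (2,5,3,7); (8,8,9,9);
  (8,9,9,8)]);
 (10%nat, 6%nat, [:: (3,8,9,9); (3,2,6,1); (2,6,3,5); (4,1,9,8); (4,9,8,5);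
  (2,7,8,8); (8,9,9,2); (3,7,4,5); (1,0,3,9); (3,6,8,7); (1,7,9,6); (6,6,9,0);
  (4,7,6,9); (2,1,7,7); (7,5,8,0); (7,0,9,7); (6,5,7,1); (5,9,6,8); (5,0,8,1);
  (4,2,5,6); (3,0,5,8); (2,9,5,1); (1,6,2,8); (2,4,6,0); (2,5,9,4); (6,4,8,6);
  (1,9,7,4); (6,2,7,8); (1,2,4,0); (1,4,5,7); (3,4,7,2); (0,2,9,5); (0,6,7,9);
  (0,1,4,6); (0,8,8,4); (0,4,3,1); (0,5,1,8); (0,7,5,2); (5,3,7,6); (0,3,6,7);
  (4,8,7,3); (8,3,9,1); (1,3,8,2); (2,0,4,3); (5,4,9,3); (1,5,6,3); (0,9,2,3)]);
 (10%nat, 8%nat, [:: (0,7,2,5); (1,6,3,4); (2,9,4,5); (3,9,5,4); (2,6,9,1);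
  (3,7,9,0); (4,3,9,5); (5,2,9,4); (6,4,9,7); (7,5,9,6); (0,3,7,9); (1,2,6,9);
  (4,1,6,3); (5,0,7,2); (4,9,7,6); (5,9,6,7); (0,4,6,8); (1,5,7,8); (2,3,5,8);
  (3,2,4,8); (0,6,5,3); (1,7,4,2); (0,8,4,7); (1,8,5,6); (0,9,3,1); (1,9,2,0);
  (2,1,7,4); (3,0,6,5); (2,8,6,0); (3,8,7,1); (0,1,9,2); (1,0,9,3); (6,1,8,5);
  (7,0,8,4); (2,4,8,3); (3,5,8,2); (4,6,8,0); (5,7,8,1); (0,2,8,6); (1,3,8,7);
  (4,0,5,1); (6,2,7,3); (0,5,1,4); (2,7,3,6); (8,8,9,9); (8,9,9,8)]);
 (10%nat, 10%nat, [:: (3,1,7,2); (4,2,8,0); (5,0,6,1); (0,8,7,6); (1,6,8,7);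
  (2,7,6,8); (0,1,4,8); (1,2,5,6); (2,0,3,7); (3,9,8,6); (4,9,6,7); (5,9,7,8);
  (3,2,4,7); (4,0,5,8); (5,1,3,6); (0,2,6,9); (1,0,7,9); (2,1,8,9); (0,7,9,1);
  (1,8,9,2); (2,6,9,0); (0,9,3,5); (1,9,4,3); (2,9,5,4); (0,3,5,2); (1,4,3,0);
  (2,5,4,1); (3,4,9,8); (4,5,9,6); (5,3,9,7); (0,5,1,7); (1,3,2,8); (2,4,0,6);
  (3,8,6,5); (4,6,7,3); (5,7,8,4); (0,4,8,3); (1,5,6,4); (2,3,7,5); (6,0,9,3);
  (7,1,9,4); (8,2,9,5); (6,2,7,4); (7,0,8,5); (8,1,6,3)])
].

(* Verification of the data and the resulting ingredients *)
Local Close Scope N_scope.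

Definition family_ok h (row : difference_family) :=
  let: (t, u, fin, iw, im) := row in
  (0 < t) && difference_ok h t u (base_matches (N.of_nat (h * t)) fin iw im).

Lemma families_ok : all (family_ok 4) families4 && all (family_ok 2) families2.
Proof. by vm_compute. Qed.

Lemma family_frame h row : 0 < h -> family_ok h row ->
  let: (t, u, _, _, _) := row in frame h t u.
Proof.
by case: row => [[[[t u] fin] iw] im] h0 /andP[t0 /cyclic_frame]; apply.
Qed.

Definition match_of_tuple (q : N * N * N * N) : match_of N :=
  let: (a, b, c, d) := q in ((a, b), (c, d)).

Lemma frame_2_4_0 : frame 2 4 0.
Proof.
(* Division by 2 numbers the four holes; class 4, the hole of size [u = 0], is empty. *)
exists N, (iotaN 8), (fun x => N.to_nat (x / 2)),
  (map match_of_tuple frame_2_4_0_matches).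
split; [exact: iotaN_uniq | by apply/allP; vm_compute | | | by vm_compute].
  move=> r x y; have chk : meets_as (iotaN 8)
      (fun _ x y => N.to_nat (x / 2) != N.to_nat (y / 2) : nat)
      (map match_of_tuple frame_2_4_0_matches) by vm_compute.
  by rewrite (meets_asP (iotaN_uniq 8) chk) mulnb andbA.
by case=> [|[|[|[|j]]]] // _; vm_compute.
Qed.

(** The value 3 is the largest that counting matches allows. Three of the frames are cyclic over
    Z_8; [b = 0] needs the explicit one. *)
Lemma frame_2_4 b : b <= 3 -> frame 2 4 b.
Proof.
have /andP[_] := families_ok; rewrite -[families2]/(_ :: _).
case/and4P=> F1 F2 F3 _; have rf r := @family_frame 2 r isT.
move/rf: F1 => F1; move/rf: F2 => F2; move/rf: F3 => F3.
by case: b => [|[|[|[|b]]]] // _; first exact: frame_2_4_0.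
Qed.

Lemma sum_ltn m r : \sum_(i < m) (i < r) = minn m r.
Proof.
by elim: m => [|m IH]; rewrite ?big_ord0 ?min0n // big_ord_recr IH /=; lia.
Qed.

(** The weights on the fifth group are spread as evenly as possible: each is [u %/ m] or one more,
    so none exceeds 3 when [u <= 3 * m]. *)
Lemma frame_weight2 m u :
  1 < m -> coprime m 6 -> u <= 3 * m -> frame (2 * m) 4 u.
Proof.
move=> m1 cm um.
have cR : #|'Z_m| = m by rewrite card_ord Zp_cast.
rewrite -{1}cR; pose wt (a : 'Z_m) := u %/ m + (a < u %% m).
apply: (@transversal_frame _ 2 u wt) => // [d d4|a|].
- rewrite unitZpE //; have : coprime m (2 * 3) by [].
  rewrite coprimeMr => /andP[c2 c3].
  by case: d d4 => [|[|[|[|]]]] //; rewrite coprimen1.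
- apply: frame_2_4; rewrite /wt; case: ltnP => /= am; last first.
    by rewrite addn0 -(mulnK 3 (ltnW m1)) leq_div2r.
  (* A point of larger weight exists only if the remainder is nonzero, and then [u %/ m] is at most
     2. *)
  have := divn_eq u m; have : u %/ m <= 3; last by nia.
  by rewrite -(mulnK 3 (ltnW m1)) leq_div2r.
rewrite big_split /= sum_nat_const cR mulnC [RHS](divn_eq u m); congr (_ + _).
rewrite sum_ltn Zp_cast //; apply/minn_idPr.
by rewrite ltnW // ltn_pmod // ltnW.
Qed.

(** Here [tau] exchanges [k + 2i] and [k + 2i + 1]. Below [k] the truncated subtraction gives a
    meaningless value, but these players have spouses and [demand] ignores [tau] for them. *)
Definition tournament_ok (row : nat * nat * seq (N * N * N * N)) :=
  let: (n, k, ms) := row in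
  let sp x := (x <? N.of_nat k)%num in
  let tau x := if N.even (x - N.of_nat k) then (x + 1)%num else (x - 1)%num in
  [&& count sp (iotaN n) == k,
      all (fun x => sp x || [&& tau x \in iotaN n, tau x != x & ~~ sp (tau x)])
        (iotaN n) &
      meets_as (iotaN n) (demand sp (fun _ => tau)) (map match_of_tuple ms)].

Lemma small_tournaments_ok : all tournament_ok small_tournaments.
Proof. by vm_compute. Qed.

Lemma small_avail n k :
  has (fun row => row.1 == (n, k)) small_tournaments -> avail n k.
Proof.
case/hasP=> -[[n' k'] S] /(allP small_tournaments_ok) chk /= /eqP[<- <-].
move: chk; rewrite /tournament_ok; set sp := fun x => (x <? _)%num.
set tau := fun x => if _ then _ else _.
case/and3P=> /eqP cs /allP taus mt.
have -> : n' = size (iotaN n') by rewrite size_map size_iota.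
rewrite -cs; apply: (@avail_intro _ _ _ (map match_of_tuple S)) (iotaN_uniq n') _.
exists (fun _ => tau) => [r x Vx spx|r x y].
  by have /orP[spx2|/and3P[]] := taus x Vx; first by case/negP: spx.
by rewrite (meets_asP (iotaN_uniq n') mt) /= andbT.
Qed.

Lemma small_universal n : n \in [:: 0; 1; 7; 8; 9; 10] -> universal n.
Proof.
move=> ns k kn ek; apply: small_avail.
(* It is checked that the table has a row for each of these sizes and every [k] of the right
   parity. *)
have /allP/(_ n ns)/allP : all (fun n => all (fun k => odd (n - k) ||
    has (fun row => row.1 == (n, k)) small_tournaments) (iota 0 n.+1))
  [:: 0; 1; 7; 8; 9; 10] by vm_compute.
by move=> /(_ k); rewrite mem_iota (negPf ek); apply.
Qed.

(** * Induction on the number of players *)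

(** The sizes 27, 28 and 31 are below the range of the theorem but serve as last holes: 163, 164 and
    167 are obtained from [m = 17] as 136 plus one of them. The sizes 29 and 30 would need [t = 5]
    with [u = 9] or [u = 10], beyond the counting bound. *)
Definition reachable n :=
  [|| n \in [:: 0; 1; 7; 8; 9; 10], n \in [:: 27; 28; 31] | 32 <= n].

Definition directly_framed n := has (fun row =>
  let: (t, u, _, _, _) := row in
  [&& n == 4 * t + u, 2 <= u, 0 < t & reachable u]) families4.

Definition weight2_step n m :=
  [&& 1 < m, coprime m 6, 8 * m <= n, n - 8 * m <= 3 * m,
      reachable (2 * m) & reachable (n - 8 * m)].

(** The number [m = 6j + 1] is coprime to 6, and [8m = 48j + 8]. Writing [n - 40 = 48j + r] with
    [r < 48] gives a last hole of size [32 + r], between 32 and 79, whereas [j >= 5] yields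
    [3m >= 93] and [2m >= 62]. *)
Lemma weight2_step_large n : 288 <= n -> exists m, weight2_step n m.
Proof.
move=> n288; pose j := (n - 40) %/ 48; exists (6 * j + 1).
have cm : coprime (6 * j + 1) 6 by rewrite coprime_sym /coprime mulnC gcdnMDl.
rewrite /weight2_step cm /reachable.
have := divn_eq (n - 40) 48; have := ltn_pmod (n - 40) (isT : 0 < 48).
rewrite -/j; move: (_ %% _) => r r48 nE.
have -> : 32 <= 2 * (6 * j + 1) by lia.
have -> : 32 <= n - 8 * (6 * j + 1) by lia.
by rewrite !orbT !andbT; lia.
Qed.

Lemma reachable_step n : reachable n -> n \notin [:: 0; 1; 7; 8; 9; 10] ->
  directly_framed n \/ exists m, weight2_step n m.
Proof.
move=> rn nb; have [n288|n288] := leqP 288 n.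
  by right; exact: weight2_step_large.
(* Below 288 a computation decides; 5 is the first [m] above 1 that is coprime to 6. The two
   isolated rows of [families4], with [t = 45] and [t = 51], serve 213 and 214, for which [m = 23]
   would leave the unreachable 29 and 30. *)
have /allP/(_ n) : all (fun n =>
    [|| ~~ reachable n, n \in [:: 0; 1; 7; 8; 9; 10], directly_framed n
      | has (weight2_step n) (iota 5 (n %/ 8))]) (iota 0 288).
  by vm_compute.
rewrite mem_iota rn (negPf nb) /= => /(_ n288)/orP[|/hasP[m _ nm]].
  by left.
by right; exists m.
Qed.

Lemma reachable_universal n : reachable n -> universal n.
Proof.
have [N] := ubnP n; elim: N n => // N IH n nN rn.
have [/small_universal//|nb] := boolP (n \in [:: 0; 1; 7; 8; 9; 10]).
have [/hasP[[[[[t u] fin] iw] im] row]|[m]] := reachable_step rn nb.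
  case/and4P=> /eqP nE u2 t0 ru.
  have /andP[/allP/(_ _ row)/(@family_frame 4 _ isT) F _] := families_ok.
  rewrite nE; apply: frame4_universal => //; [exact: small_avail.. |].
  (* The last hole is smaller than [n] because [t] is positive. *)
  by apply: IH => //; lia.
case/and5P=> m1 cm mn nm /andP[r2 ru].
have -> : n = 2 * m * 4 + (n - 8 * m) by lia.
apply: frame_universal; first exact: frame_weight2.
- by rewrite oddM.
- by apply: IH => //; lia.
by apply: IH => //; lia.
Qed.

(** * From matches back to games *)

Lemma mem_all_pairs (T : eqType) (S : seq (match_of T)) r x y :
  ((x, y) \in all_pairs r S) = (0 < meets S r x y).
Proof. by rewrite -has_pred1 has_count. Qed.

(** The statement of the theorem counts games, whereas [meets] counts listed pairs. The two agree
    when no match lists the same pair twice, which will follow from the two men and the two women of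
    a match being distinct. *)
Lemma count_meets (T : eqType) (S : seq (match_of T)) r x y :
  {in S, forall g, uniq (pairs r g)} ->
  count (fun g => (x, y) \in pairs r g) S = meets S r x y.
Proof.
elim: S => [|g S IH] // uS; rewrite /meets /all_pairs /= count_cat.
rewrite count_uniq_mem ?uS ?mem_head // -/(all_pairs r S) -/(meets S r x y).
rewrite -IH // => g' Sg'.
by apply: uS; rewrite inE Sg' orbT.
Qed.

Definition game_of_match n (g : match_of 'I_n) : game n :=
  let: ((a, b), (c, d)) := g in Game a b c d.

Theorem theorem4 (n k : nat) :
  32 <= n -> k <= n -> ~~ odd (n - k) ->
  exists s : seq (game n), @is_CMDRR n k s.
Proof.
move=> n32 kn ek.
have rn : reachable n by rewrite /reachable n32 !orbT.
have cnt : count (fun p : 'I_n => p < k) (enum 'I_n) = k.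
  rewrite -sum1_count big_mkcond big_enum /= -[RHS](minn_idPr kn) -sum_ltn.
  by apply: eq_bigr => i _; case: ltnP.
have [ms [tau tauP msP]] :=
  reachable_universal rn kn ek (enum_uniq 'I_n) (size_enum_ord n) cnt.
have {}msP r x y : meets ms r x y = demand (fun p : 'I_n => p < k) tau r x y.
  by rewrite msP !mem_enum mul1n.
have {}tauP r (x : 'I_n) : ~~ (x < k) -> tau r x != x /\ ~~ (tau r x < k).
  by move=> xk; have [||_ _] := tauP r x; rewrite ?mem_enum.
have sub g r p : g \in ms -> p \in pairs r g -> p \in all_pairs r ms.
  by move=> gms pg; apply/flattenP; exists (pairs r g) => //; apply: map_f.
(* Nobody opposes himself: the demand on the diagonal is 0 because [tau r x] differs from [x]. *)
have irr r x : r = OppMM \/ r = OppWW -> (x, x) \notin all_pairs r ms.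
  rewrite mem_all_pairs msP -eqn0Ngt.
  have [xk [->|->]|xk rr] := boolP (x < k); rewrite /= ?eqxx ?xk //.
  have [tx _] := tauP r x xk.
  by rewrite eq_sym in tx; case: rr tx => -> tx; rewrite /= eqxx (negPf tx) andbF.
have distinct g : g \in ms -> g.1.1 != g.2.1 /\ g.1.2 != g.2.2.
  case: g => [[a b] [c d]] gms /=; split; apply/negP => /eqP e.
    by have /negP[] := irr OppMM a (or_introl erefl);
      apply: (sub _ _ _ gms); rewrite e mem_head.
  by have /negP[] := irr OppWW b (or_intror erefl);
    apply: (sub _ _ _ gms); rewrite e mem_head.
have upairs r : {in ms, forall g, uniq (pairs r g)}.
  move=> [[a b] [c d]] /distinct /= [ac bd].
  by case: r; rewrite /= inE xpair_eqE negb_and ?ac ?bd // ?orbT.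
exists (map (@game_of_match n) ms).
have cntP m w : partners_cnt (map (@game_of_match n) ms) m w =
    meets ms Partners m w.
  rewrite -count_meets // /partners_cnt count_map.
  apply: eq_count => -[[a b] [c d]] /=.
  by rewrite !inE !xpair_eqE ![_ == m]eq_sym ![_ == w]eq_sym.
have cntO m w : opp_mw_cnt (map (@game_of_match n) ms) m w =
    meets ms OppMW m w.
  rewrite -count_meets // /opp_mw_cnt count_map.
  apply: eq_count => -[[a b] [c d]] /=.
  by rewrite !inE !xpair_eqE ![_ == m]eq_sym ![_ == w]eq_sym.
have cntM m w : opp_mm_cnt (map (@game_of_match n) ms) m w =
    meets ms OppMM m w.
  rewrite -count_meets // /opp_mm_cnt count_map.
  apply: eq_count => -[[a b] [c d]] /=.
  by rewrite !inE !xpair_eqE ![_ == m]eq_sym ![_ == w]eq_sym [(w == a) && _]andbC.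
have cntW m w : opp_ww_cnt (map (@game_of_match n) ms) m w =
    meets ms OppWW m w.
  rewrite -count_meets // /opp_ww_cnt count_map.
  apply: eq_count => -[[a b] [c d]] /=.
  by rewrite !inE !xpair_eqE ![_ == m]eq_sym ![_ == w]eq_sym [(w == b) && _]andbC.
(* Both sexes are treated at once; the opponent met twice is [tau r p]. *)
have same r opp : r = OppMM \/ r = OppWW ->
    (forall x y, opp x y = meets ms r x y) -> same_sex_ok k opp.
  move=> rr oppE p; rewrite /has_spouse; split=> [pk q|pk].
    by rewrite oppE msP eq_sym => qp; case: rr => ->; rewrite /= qp pk.
  have [tp tk] := tauP r p pk; exists (tau r p); first by rewrite tp.
  rewrite eq_sym in tp; split=> [|q qp qt]; rewrite oppE msP.
    by case: rr tp => -> tp; rewrite /= tp pk eqxx.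
  rewrite eq_sym in qp.
  by case: rr qt => -> qt; rewrite /= qp pk (negPf qt).
split; last split; last split; last split.
- rewrite all_map; apply/allP => -[[a b] [c d]] /distinct /= [ac bd].
  by rewrite /game_ok /= ac.
(* Spouses have the same index. A game with both of them would make them partners or opponents; each
   of the four possible positions contradicts a demand of 0. *)
- move=> m w /andP[/eqP/val_inj <- mk].
  apply/eqP; rewrite count_map eqn0Ngt -has_count.
  apply/hasPn => -[[a b] [c d]] gms /=.
  have noP : (m, m) \notin all_pairs Partners ms.
    by rewrite mem_all_pairs msP /= eqxx mk.
  have noO : (m, m) \notin all_pairs OppMW ms.
    by rewrite mem_all_pairs msP /= eqxx mk.
  apply/negP => /andP[/orP[]/eqP e /orP[]/eqP e'].
  + by case/negP: noP; apply: (sub _ _ _ gms); rewrite -{1}e -e' mem_head.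
  + by case/negP: noO; apply: (sub _ _ _ gms); rewrite -{1}e -e' mem_head.
  + by case/negP: noO; apply: (sub _ _ _ gms); rewrite -{1}e -e' !inE eqxx orbT.
  + by case/negP: noP; apply: (sub _ _ _ gms); rewrite -{1}e -e' !inE eqxx orbT.
- move=> m w nsp; rewrite cntP cntO !msP /=.
  by rewrite -val_eqE; move: nsp; rewrite /spouses => ->.
- exact: (same OppMM _ (or_introl erefl)).
- exact: (same OppWW _ (or_intror erefl)).
Qed.
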